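(* Let $1<p<\infty$ and $-1<\alpha<\infty$. There is a constant $C$ depending only on $p$ and $\alpha$ such that for every Békollé weight $w\in B_{p,\alpha}$, with constant $B_{p,\alpha}(w)$, and every $f\in L^{p}(w\,dA_{\alpha})$, $$\|P_{\alpha}f\|_{L^{p}(w\,dA_{\alpha})}\leq C\, B_{p,\alpha}(w)^{\max\left(1,\frac{1}{p-1}\right)}\,\|f\|_{L^{p}(w\,dA_{\alpha})},$$ where $P_\alpha$ is the Bergman projection.
   Context: $\mathcal H=\{z\in\mathbb C:\operatorname{Im} z>0\}$ is the upper half plane, $dA$ is area (Lebesgue) measure on $\mathcal H$, and $dA_{\alpha}(z)=(\operatorname{Im} z)^{\alpha}dA(z)$. For a positive function $w$ on $\mathcal H$, $L^p(w\,dA_\alpha)$ is the $L^p$ space on $\mathcal H$ with respect to the measure $w\,dA_\alpha$. The Bergman space $A^2_\alpha(\mathcal H)$ is the space of analytic functions in $L^2(dA_\alpha)$. The Bergman projection $P_\alpha$ is the integral operator $$P_{\alpha}f(z)=c_\alpha\int_{\mathcal H}\frac{f(\xi)}{(z-\bar\xi)^{2+\alpha}}\,dA_{\alpha}(\xi),\qquad z\in\mathcal H,$$ where $c_\alpha$ is the normalizing constant, depending only on $\alpha$, for which this formula gives the orthogonal projection of $L^2(dA_\alpha)$ onto $A^2_\alpha(\mathcal H)$. The power is taken with the principal branch (note $z-\bar\xi\in\mathcal H$ for $z,\xi\in\mathcal H$). For a (bounded) interval $I\subset\mathbb R$ with length $|I|$, the Carleson box is $Q_I=I\times[0,|I|]$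 (identifying $x+iy$ with $(x,y)$; only its part in $\mathcal H$ matters for integration). Write $|Q_I|_\alpha=\int_{Q_I}dA_\alpha$ and $|Q_I|_{w,\alpha}=\int_{Q_I}w\,dA_\alpha$. With $p'$ defined by $\frac1p+\frac1{p'}=1$, the class $B_{p,\alpha}$ of Békollé weights consists of the positive locally integrable functions $w$ on $\mathcal H$ for which $$B_{p,\alpha}(w):=\sup_{I\subset\mathbb R\text{ interval}}\frac{|Q_I|_{w,\alpha}}{|Q_I|_\alpha}\left(\frac{|Q_I|_{w^{1-p'},\alpha}}{|Q_I|_\alpha}\right)^{p-1}<\infty .$$ *)

(* Defs.v *)
From HB Require Import structures.
From mathcomp Require Import all_boot all_order all_algebra.
From mathcomp Require Import complex.
From mathcomp Require Import all_classical all_reals all_analysis.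
Set Implicit Arguments.
Unset Strict Implicit.
Unset Printing Implicit Defensive.
Import Order.TTheory GRing.Theory Num.Theory.
Import numFieldNormedType.Exports.
Import ComplexField.Normc.

Local Open Scope classical_set_scope.
Local Open Scope ring_scope.
Local Open Scope complex_scope.

Section bergman_halfplane.
Context {R : realType}.
Local Notation Re := complex.Re.
Local Notation Im := complex.Im.
Implicit Types (p a s c : R) (w : R * R -> R) (f g : R * R -> R[i]).

(* A point x + iy of the plane is the pair (x, y) : R * R, so that area is the
   product Lebesgue measure; [toC] is the identification with R[i]. *)
Local Notation area := ((@lebesgue_measure R) \x (@lebesgue_measure R))%E.

Definition toC (z : R * R) : R[i] := z.1 +i* z.2.

Definition halfplane : set (R * R) := [set z | 0 < z.2].

(* \int_(D `&` halfplane) h dA_a, where dA_a = (Im z)^a dA *)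
Definition int_dA a (D : set (R * R)) (h : R * R -> \bar R) : \bar R :=
  (\int[area]_(z in D `&` halfplane) (h z * (z.2 `^ a)%:E))%E.

Definition integrable_dA a f : Prop :=
  area.-integrable halfplane (fun z => (Re (f z) * z.2 `^ a)%:E) /\
  area.-integrable halfplane (fun z => (Im (f z) * z.2 `^ a)%:E).

(* Only meaningful when [integrable_dA a f] holds. *)
Definition cint_dA a f : R[i] :=
  fine (int_dA a halfplane (fun z => (Re (f z))%:E)) +i*
  fine (int_dA a halfplane (fun z => (Im (f z))%:E)).

Definition Lp_norm p a w f : \bar R :=
  ((int_dA a halfplane (fun z => (normc (f z) `^ p * w z)%:E)) `^ p^-1)%E.

Definition Lp_space p a w f : Prop :=
  [/\ measurable_fun halfplane (fun z => Re (f z)),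
      measurable_fun halfplane (fun z => Im (f z)) &
      (Lp_norm p a w f < +oo)%E].

Definition analytic_on_halfplane f : Prop :=
  forall z : R[i], 0 < Im z ->
    derivable ((fun u => f (Re u, Im u)) : (R[i])^o -> (R[i])^o) z 1.

Definition bergman_space a f : Prop :=
  Lp_space 2 a (fun=> 1) f /\ analytic_on_halfplane f.

(* principal argument, in ]-pi, pi] for z != 0 *)
Definition Arg (z : R[i]) : R :=
  if 0 <= Im z then acos (Re z / normc z) else - acos (Re z / normc z).

(* principal branch of z ^ s for z != 0 *)
Definition cpowR (z : R[i]) s : R[i] :=
  (normc z `^ s * cos (s * Arg z)) +i* (normc z `^ s * sin (s * Arg z)).

Definition bergman_integrand a f (z xi : R * R) : R[i] :=
  f xi / cpowR (toC z - conjc (toC xi)) (2 + a).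

Definition bergman_op a (k : R[i]) f (z : R * R) : R[i] :=
  k * cint_dA a (bergman_integrand a f z).

(* [bergman_op a k] is the orthogonal projection of L^2(dA_a) onto the
   Bergman space: P f is in the space and f - P f is orthogonal to it. *)
Definition normalizing a (k : R[i]) : Prop :=
  forall f, Lp_space 2 a (fun=> 1) f ->
    bergman_space a (bergman_op a k f) /\
    forall g, bergman_space a g ->
      cint_dA a (fun z => (f z - bergman_op a k f z) * conjc (g z)) = 0.

(* For a > -1 exactly one k is normalizing, 2^a (a + 1) / pi * 'i^(2 + a);
   the default value 1 is then irrelevant. *)
Definition bergman_cst a : R[i] := xget 1 [set k | normalizing a k].

Definition bergman_proj a f : R * R -> R[i] := bergman_op a (bergman_cst a) f.

(* Carleson box over the interval with endpoints u < v *)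
Definition carleson_box (u v : R) : set (R * R) := `[u, v] `*` `[0, v - u].

Definition conjugate_exponent p : R := (1 - p^-1)^-1.

Definition box_average a w (Q : set (R * R)) : \bar R :=
  (int_dA a Q (fun z => (w z)%:E) / int_dA a Q (fun=> 1))%E.

Definition dual_weight p w (z : R * R) : R := w z `^ (1 - conjugate_exponent p).

Definition bekolle_cst p a w : \bar R :=
  ereal_sup [set r | exists u v : R, u < v /\
    r = (box_average a w (carleson_box u v) *
         box_average a (dual_weight p w) (carleson_box u v) `^ (p - 1))%E].

Definition locally_integrable_on_halfplane w : Prop :=
  measurable_fun halfplane w /\
  forall K : set (R * R), compact K -> K `<=` halfplane ->
    (\int[area]_(z in K) `|(w z)%:E| < +oo)%E.

Definition bekolle_weight p a w : Prop :=
  [/\ forall z, halfplane z -> 0 < w z,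
      locally_integrable_on_halfplane w &
      (bekolle_cst p a w < +oo)%E].

End bergman_halfplane.

(* Main.v *)
Require Import Defs.
From HB Require Import structures.
From mathcomp Require Import all_boot all_order all_algebra.
From mathcomp Require Import complex.
From mathcomp Require Import all_classical all_reals all_analysis.
From mathcomp Require Import measurable_realfun.
From mathcomp Require Import ring lra.
Set Implicit Arguments.
Unset Strict Implicit.
Unset Printing Implicit Defensive.
Import Order.TTheory GRing.Theory Num.Theory.
Import numFieldNormedType.Exports.
Local Open Scope classical_set_scope.
Local Open Scope ring_scope.

(** The kernel of the Bergman projection has modulus
    [c |z - conj xi| ^ (- (2 + alpha))] with [c] depending on [alpha] only, so it
    is enough to bound the positive operator [T] with kernel
    [|z - conj xi| ^ (- (2 + alpha))] ([abs_op], [bergman_proj_pointwise]).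

    Positivity makes [T] dyadic.  If [z] and [xi] stay in a compact part of the
    half-plane, they lie in a common Carleson box of side at most
    [6 |z - conj xi|], taken from one of two dyadic trees that are shifted by a
    third of the root interval ([one_third_trick], [common_dyadic_box]).  On
    such a box [Q] the kernel is at most a constant over the mass [M_Q] of [Q],
    hence the truncated [T f] is at most a constant times the sum, over the two
    trees, of [A f = \sum_Q 1_Q F_Q / M_Q], where [F_Q] is the integral of [f]
    over [Q] ([truncated_op_le]).

    The heart of the proof is the weighted bound for [A]
    ([sparse_operator_bound]).  Let [q] be the conjugate exponent and [s] the
    dual weight.  Testing [A f] against [g = (A f) ^ (p - 1)] writes the [p]-th
    power of its norm as [\sum_Q F_Q G_Q / M_Q], where [G_Q] is the integral of
    [g w] over [Q].  The upper halves [E_Q] of the boxes are disjoint and carry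
    a fixed fraction of the mass.  If [W], [S] denote the integrals of [w], [s],
    the weight condition on [Q] and the Hoelder inequality on [E_Q] give
    [W_Q S_Q / M_Q <= K W_E ^ (1/q) S_E ^ (1/p)] with [K] of the order of the
    power [max 1 (1/(p - 1))] of the constant of the weight ([node_bound]): for
    [2 <= p] the condition is used as it stands, and the case [p < 2] is the
    same statement with the two weights exchanged.  The Young inequality then
    separates the sum into [\sum_Q (F_Q / S_Q) ^ p S_E] and
    [\sum_Q (G_Q / W_Q) ^ q W_E], with a free parameter [t] in front
    ([node_young]).  Each of them is a Carleson sum over disjoint sets, and is
    controlled by the [L^p] norm of the density through an induction along the
    tree that uses nothing but the tangent lines of [t ^ p]
    ([tree_carleson]).  The second sum is controlled by the quantity that is
    being estimated; a suitable [t] absorbs it ([absorb_exponent]).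

    The number of levels of the trees does not enter the bound, so monotone
    convergence gives the estimate for [T] on the whole half-plane
    ([abs_op_bound]).  Finiteness of [T f] at every point, which gives absolute
    convergence of the Bergman integral, comes from the same estimate: [T f] at
    a point is at most a multiple of [T f] at every point of a small square, and
    the weight has positive mass on that square
    ([truncated_op_unif_bounded]). *)

(** * Elementary inequalities *)

Section real_inequalities.
Context {R : realType}.
Implicit Types (p q t c x y s : R).

(** By convexity the tangent at [c] lies below [t ^ p].  Being affine in [t],
    it can be integrated, and it replaces the Jensen inequality below. *)
Lemma tangent_powR p t c : 1 < p -> 0 <= t -> 0 <= c ->
  p * c `^ (p - 1) * t - (p - 1) * c `^ p <= t `^ p.
Proof.
move=> p1 t0 c0.
have p0 : 0 < p by lra.
have q0 : 0 < p / (p - 1) by rewrite divr_gt0//; lra.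
have pq : p^-1 + (p / (p - 1))^-1 = 1 by field; rewrite ?gt_eqF//; lra.
have := conjugate_powR t0 (powR_ge0 c (p - 1)) p0 q0 pq.
rewrite -powRrM mulrCA divff ?mulr1; last by rewrite gt_eqF//; lra.
rewrite -(ler_pM2l p0) mulrDr [p * (t `^ p / p)]mulrC mulfVK ?gt_eqF//.
have -> : p * (c `^ p / (p / (p - 1))) = (p - 1) * c `^ p.
  by field; rewrite ?gt_eqF//; lra.
by rewrite lerBlDr mulrA mulrAC.
Qed.

(** The perspective of [tangent_powR]: [(x, s) |-> (x / s) ^ p * s] is convex
    and homogeneous, so it dominates functions linear in [(x, s)], and these add
    up over disjoint sets. *)
Lemma tangent_perspective p x s c : 1 < p -> 0 <= x -> 0 < s -> 0 <= c ->
  p * c `^ (p - 1) * x - (p - 1) * c `^ p * s <= (x / s) `^ p * s.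
Proof.
move=> p1 x0 s0 c0.
have := tangent_powR p1 (divr_ge0 x0 (ltW s0)) c0.
rewrite -(ler_pM2r s0); congr (_ <= _).
by field; rewrite gt_eqF.
Qed.

(** The parameter [t] makes the right-hand side linear in [(x, y)], hence
    integrable termwise; optimizing [t] afterwards yields the Hoelder
    inequality, see [mass_hoelder]. *)
Lemma weighted_amgm p q t x y : 1 < p -> 1 < q -> p^-1 + q^-1 = 1 -> 0 < t ->
  0 <= x -> 0 <= y ->
  x `^ p^-1 * y `^ q^-1 <= t `^ q^-1 * x / p + t `^ (- p^-1) * y / q.
Proof.
move=> p1 q1 pq t0 x0 y0.
have p0 : 0 < p by lra.
have q0 : 0 < q by lra.
have pn : p != 0 by rewrite gt_eqF.
have qn : q != 0 by rewrite gt_eqF.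
set a := t `^ (p^-1 * q^-1).
have a0 : 0 < a by rewrite powR_gt0.
have := conjugate_powR (mulr_ge0 (ltW a0) (powR_ge0 x p^-1))
  (mulr_ge0 (ltW (powR_gt0 (- (p^-1 * q^-1)) t0)) (powR_ge0 y q^-1)) p0 q0 pq.
rewrite !powRM ?powR_ge0// -!powRrM !mulVf// !powRr1//.
rewrite mulNr mulfVK// [p^-1 / q * p]mulrAC mulVf// mul1r.
congr (_ <= _).
rewrite mulrACA /a -powRD ?subrr ?powRr0 ?mul1r//.
by rewrite (gt_eqF t0) implybT.
Qed.
End real_inequalities.

(** * Sums over a binary tree and the Carleson embedding *)

Section binary_tree.
Context {R : realType}.
Implicit Types (h : nat -> nat -> R) (p : R).

(** Nodes are pairs (level, index); the children of [(k, i)] are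
    [(k.+1, 2 i)] and [(k.+1, 2 i + 1)], so the node [(k, i)] of the tree rooted
    at [(0, 0)] stands for the [i]-th dyadic interval of generation [k].  The
    sum runs over the [n] first generations below [(k, i)]. *)
Fixpoint tree_sum h (n k i : nat) : R :=
  if n is n'.+1 then
    h k i + tree_sum h n' k.+1 i.*2 + tree_sum h n' k.+1 i.*2.+1
  else 0.

(** Masses of boxes: a box is the disjoint union of its upper half, of mass
    [XE], and of its two children. *)
Definition tree_additive (X XE : nat -> nat -> R) :=
  forall k i, X k i = XE k i + X k.+1 i.*2 + X k.+1 i.*2.+1.

Lemma le_tree_sum h1 h2 n k i : (forall k i, h1 k i <= h2 k i) ->
  tree_sum h1 n k i <= tree_sum h2 n k i.
Proof. by move=> h12; elim: n k i => //= n ih k i; rewrite !lerD. Qed.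

Lemma tree_sum_lin h1 h2 (a b : R) n k i :
  tree_sum (fun k i => a * h1 k i + b * h2 k i) n k i =
  a * tree_sum h1 n k i + b * tree_sum h2 n k i.
Proof. by elim: n k i => /= [|n ih] k i; rewrite ?ih; ring. Qed.

(** The Carleson embedding theorem for the measures [SE], without a maximal
    function.  The two last hypotheses are the integrals of
    [tangent_perspective] over the upper half and over the box; they say that
    [X] is at least the integral of the [p]-th power of the density of [F] with
    respect to [S].  For the induction one proves more: the left-hand side may
    be increased by any tangent in which [S] is enlarged by the sum of [SE] over
    the same [n] generations.  The enlarged mass stays below [2 S], whence the
    factor [2 ^ (- p)]. *)
Lemma tree_carleson p (F FE S SE X XE : nat -> nat -> R) n k i : 1 < p ->
  tree_additive F FE -> tree_additive S SE -> tree_additive X XE ->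
  (forall k i, 0 <= F k i) -> (forall k i, 0 < SE k i) ->
  (forall k i, 0 < S k i) ->
  (forall k i c, 0 <= c ->
     p * c `^ (p - 1) * FE k i - (p - 1) * c `^ p * SE k i <= XE k i) ->
  (forall k i c, 0 <= c ->
     p * c `^ (p - 1) * F k i - (p - 1) * c `^ p * S k i <= X k i) ->
  (p - 1) * 2 `^ (- p) *
    tree_sum (fun k i => (F k i / S k i) `^ p * SE k i) n k i <= X k i.
Proof.
move=> p1 aF aS aX F0 SE0 S0 lE lQ.
pose h k i := (F k i / S k i) `^ p * SE k i.
pose V n := S k i + tree_sum SE n k i.
have V2 m : forall k i, tree_sum SE m k i <= S k i.
  elim: m => [|m ih] k' i' /=; first exact: ltW.
  by rewrite (aS k' i') !lerD.
have Vge0 m : forall k i, 0 <= tree_sum SE m k i.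
  by elim: m => [|m ih] k' i' //=; rewrite !addr_ge0// ltW.
suff H : forall c, 0 <= c ->
    (p - 1) * 2 `^ (- p) * tree_sum h n k i +
    (p * c `^ (p - 1) * F k i
     - (p - 1) * c `^ p * (S k i + tree_sum SE n k i)) <= X k i.
  have := H 0 (lexx 0); rewrite !powR0 ?mulr0 ?mul0r ?subr0 ?addr0//.
  - by rewrite gt_eqF//; lra.
  - by rewrite gt_eqF//; lra.
rewrite {V}; elim: n k i => [|n ih] k i c c0.
  by rewrite /= mulr0 add0r addr0; exact: lQ.
(* the enlarged mass [v] and the density [d] that goes with it: the tangent at
   [d] is exact at [(F, v)], so the inductive hypothesis is used with [d] *)
set v := S k i + tree_sum SE n.+1 k i.
have v0 : 0 < v by rewrite ltr_wpDr.
have v2 : v <= 2 * S k i.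
  by rewrite mulr_natl mulr2n lerD2l.
set d := F k i / v.
have d0 : 0 <= d by rewrite divr_ge0// ltW.
have T := tangent_perspective p1 (F0 k i) v0 c0.
have key : 2 `^ (- p) * h k i <= d `^ p * SE k i.
  rewrite /h mulrA ler_pM2r// powRN -powR_inv1 ?powR_ge0// powRAC powR_inv1//.
  rewrite -powRM//; last by rewrite divr_ge0// ltW.
  apply: ge0_ler_powR; rewrite ?nnegrE//; first lra.
  - by rewrite mulr_ge0// divr_ge0// ltW.
  - rewrite /d mulrCA ler_wpM2l// -invfM lef_pV2// posrE ?mulr_gt0//.
have := ih k.+1 i.*2 d d0; have := ih k.+1 i.*2.+1 d d0.
have := lE k i d d0.
have dF : F k i = d * v by rewrite /d -mulrA mulVf ?mulr1// gt_eqF.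
have eF := aF k i; have eS := aS k i.
have e1 : d * d `^ (p - 1) = d `^ p by rewrite mulr_powRB1//; lra.
have key' : (p - 1) * (2 `^ (- p) * h k i) <= (p - 1) * (d `^ p * SE k i).
  by rewrite ler_pM2l//; lra.
rewrite (aX k i).
have ev : v = SE k i + S k.+1 i.*2 + S k.+1 i.*2.+1 +
    (SE k i + tree_sum SE n k.+1 i.*2 + tree_sum SE n k.+1 i.*2.+1).
  by rewrite /v eS.
move: T; rewrite -/d.
have -> : d `^ p * v = p * d `^ (p - 1) * F k i - (p - 1) * d `^ p * v.
  by rewrite -e1 dF; ring.
rewrite [tree_sum h n.+1 k i]/=.
move: key'; rewrite {}eF {dF}.
set A := d `^ p; set A1 := d `^ (p - 1).
set C := c `^ p; set C1 := c `^ (p - 1).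
set Z := 2 `^ (- p).
rewrite ev => k1 k2 k3 k4 k5.
clear -k1 k2 k3 k4 k5.
lra.
Qed.

End binary_tree.

(** * The weight condition at one node and the weighted tree sum *)

Section weighted_node.
Context {R : realType}.
Implicit Types (p q B c t a b m w s W S WE SE mE K X G A Z : R).

(** The Hoelder inequality for the three masses [m], [w], [s], recovered from
    its family of linear consequences. *)
Lemma mass_hoelder p q m w s : 1 < p -> 1 < q -> p^-1 + q^-1 = 1 ->
  0 < w -> 0 < s ->
  (forall t, 0 < t -> m <= t `^ q^-1 * w / p + t `^ (- p^-1) * s / q) ->
  m <= w `^ p^-1 * s `^ q^-1 :> R.
Proof.
(* [t = s / w] makes the two terms on the right equal *)
move=> p1 q1 pq w0 s0 /(_ (s / w) (divr_gt0 s0 w0)) /le_trans; apply.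
have sp : 0 < s^-1 by rewrite invr_gt0.
have wp : 0 < w^-1 by rewrite invr_gt0.
have E1 : (s / w) `^ q^-1 * w = w `^ p^-1 * s `^ q^-1.
  rewrite (powRM _ (ltW s0) (ltW wp)) -(powR_inv1 (ltW w0)) -powRrM mulN1r.
  rewrite -mulrA mulrC -{2}(powRr1 (ltW w0)) -powRD; last first.
    by rewrite (gt_eqF w0) implybT.
  by congr (_ `^ _ * _); lra.
have E2 : (s / w) `^ (- p^-1) * s = w `^ p^-1 * s `^ q^-1.
  rewrite (powRM _ (ltW s0) (ltW wp)) -(powR_inv1 (ltW w0)) -powRrM mulN1r opprK.
  rewrite mulrAC -{2}(powRr1 (ltW s0)) -powRD; last first.
    by rewrite (gt_eqF s0) implybT.
  by rewrite mulrC; congr (_ * _ `^ _); lra.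
by rewrite E1 E2 -mulrDr pq mulr1.
Qed.

(** From [W S^(p-1) <= B M^p] one gets [W S / M <= B M^(p-1) S^(2-p)].  For
    [2 <= p] the exponent [2 - p] is nonpositive, so [S] may be replaced by the
    smaller [SE]; and [M] is at most [c mE], where the Hoelder inequality bounds
    [mE].  The powers of [SE] combine to [1/p]. *)
Lemma sparse_mass p q B c W S WE SE (M : R) mE : 2 <= p -> 1 < q ->
  p^-1 + q^-1 = 1 -> 0 <= c -> 0 <= B ->
  0 < W -> 0 < S -> 0 < WE -> 0 < SE -> 0 < M -> 0 <= mE ->
  SE <= S -> M <= c * mE -> mE <= WE `^ p^-1 * SE `^ q^-1 ->
  W * S `^ (p - 1) <= B * M `^ p ->
  W * S / M <= c `^ (p - 1) * B * (WE `^ q^-1 * SE `^ p^-1) :> R.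
Proof.
move=> p2 q1 pq c0 B0 W0 S0 WE0 SE0 M0 mE0 SES Mc mEh hB.
have p0 : 0 < p by lra.
have pn : p != 0 by rewrite gt_eqF.
have Sn : S != 0 by rewrite gt_eqF.
have Mn : M != 0 by rewrite gt_eqF.
have SEn : SE != 0 by rewrite gt_eqF.
have A1 : W * S / M <= B * M `^ (p - 1) * S `^ (2 - p).
  have S1 : S = S `^ (p - 1) * S `^ (2 - p).
    rewrite -powRD ?Sn ?implybT//.
    by rewrite (_ : p - 1 + (2 - p) = 1) ?powRr1 ?(ltW S0)//; lra.
  have M1 : M `^ p = M * M `^ (p - 1) by rewrite mulr_powRB1// ltW.
  rewrite {1}S1 mulrA [leLHS]mulrAC ler_wpM2r ?powR_ge0//.
  by rewrite ler_pdivrMr// -mulrA [_ * M]mulrC -M1.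
apply: le_trans A1 _; rewrite [c `^ _ * B]mulrC -!mulrA ler_wpM2l//.
have A2 : M `^ (p - 1) <= c `^ (p - 1) * (WE `^ q^-1 * SE `^ ((p - 1) / q)).
  apply: (@le_trans _ _ ((c * mE) `^ (p - 1))).
    by apply: ge0_ler_powR; rewrite ?nnegrE ?mulr_ge0 ?(ltW M0)//; lra.
  rewrite powRM// ler_wpM2l ?powR_ge0//.
  have -> : WE `^ q^-1 * SE `^ ((p - 1) / q) =
            (WE `^ p^-1 * SE `^ q^-1) `^ (p - 1).
    rewrite powRM ?powR_ge0// -!powRrM; congr (_ `^ _ * _ `^ _).
      by rewrite mulrBr mulVf// mulr1; lra.
    by rewrite mulrC.
  by apply: ge0_ler_powR; rewrite ?nnegrE ?mulr_ge0 ?powR_ge0//; lra.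
have A3 : S `^ (2 - p) <= SE `^ (2 - p).
  rewrite -opprB !powRN lef_pV2 ?posrE ?powR_gt0//.
  by apply: ge0_ler_powR; rewrite ?nnegrE ?(ltW SE0) ?(ltW S0)//; lra.
apply: le_trans (ler_pM (powR_ge0 _ _) (powR_ge0 _ _) A2 A3) _.
rewrite -!mulrA -powRD ?SEn ?implybT// le_eqVlt; apply/orP; left; apply/eqP.
do 2 congr (_ * _); congr (_ `^ _).
have -> : q^-1 = 1 - p^-1 by lra.
by field.
Qed.

(** The term of one node is split between the two Carleson sums; [t] balances
    them later. *)
Lemma node_young p q t a b WE SE : 1 < p -> 1 < q ->
  p^-1 + q^-1 = 1 -> 0 <= a -> 0 <= b -> 0 < WE -> 0 < SE -> 0 < t ->
  a * b * (WE `^ q^-1 * SE `^ p^-1) <=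
  t `^ p / p * (a `^ p * SE) + t `^ (- q) / q * (b `^ q * WE) :> R.
Proof.
move=> p1 q1 pq a0 b0 WE0 SE0 t0.
have pn : p != 0 by rewrite gt_eqF//; lra.
have qn : q != 0 by rewrite gt_eqF//; lra.
have := @conjugate_powR _ (t * (a * SE `^ p^-1)) (t `^ (-1) * (b * WE `^ q^-1)) p q.
rewrite !mulr_ge0 ?powR_ge0 ?(ltW t0)// => /(_ isT isT).
have -> : (0 < p) by lra. have -> : (0 < q) by lra.
move=> /(_ isT isT pq).
rewrite !powRM ?mulr_ge0 ?powR_ge0 ?(ltW t0)// -!powRrM !mulVf// !powRr1 ?(ltW WE0) ?(ltW SE0)//.
rewrite mulN1r (powRN t 1) (powRr1 (ltW t0)).
congr (_ <= _); last by congr (_ + _); ring.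
by field; rewrite gt_eqF.
Qed.

(** [G] is finite, so a [t] for which the coefficient of [G] on the right is
    one half absorbs that term.  This [t] is the [q]-th root of a multiple of
    [K], and [p / q = p - 1] turns [K t ^ p] into [K ^ p]. *)
Lemma absorb_exponent p q K (D1 D2 : R) X G : 1 < p -> 1 < q -> p^-1 + q^-1 = 1 ->
  0 < K -> 0 < D2 ->
  (forall t, 0 < t ->
    G <= K * (t `^ p / p * (D1 * X) + t `^ (- q) / q * (D2 * G))) ->
  G <= 2 / p * D1 * (2 * D2 / q) `^ (p - 1) * K `^ p * X :> R.
Proof.
move=> p1 q1 pq K0 D20 H.
have p0 : 0 < p by lra.
have q0 : 0 < q by lra.
have pn : p != 0 by rewrite gt_eqF.
have qn : q != 0 by rewrite gt_eqF.
have a0 : 0 < 2 * D2 / q * K by rewrite !mulr_gt0// invr_gt0.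
have := H ((2 * D2 / q * K) `^ q^-1) (powR_gt0 _ a0).
rewrite -!powRrM mulrN mulVf// powRN (powRr1 (ltW a0)).
have -> : q^-1 * p = p - 1.
  by rewrite (_ : q^-1 = 1 - p^-1); [rewrite mulrBl mulVf// mul1r|lra].
rewrite powRM ?(ltW K0)//; last by rewrite ltW// !mulr_gt0// invr_gt0.
rewrite -(mulr_powRB1 (ltW K0) p0).
set u := (_ / q) `^ _; set v := K `^ _.
have -> : K * (u * v / p * (D1 * X) + (2 * D2 / q * K)^-1 / q * (D2 * G))
   = K * u * v / p * D1 * X + 2^-1 * G.
  by field; rewrite pn qn !gt_eqF.
have -> : 2 / p * D1 * u * (K * v) * X = 2 * (K * u * v / p * D1 * X) by ring.
lra.
Qed.

Lemma conjugate_mulB1 p q : 1 < p -> 1 < q -> p^-1 + q^-1 = 1 ->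
  (p - 1) * (q - 1) = 1.
Proof.
move=> p1 q1 pq.
have pn : p != 0 by rewrite gt_eqF//; lra.
have qn : q != 0 by rewrite gt_eqF//; lra.
have : p * q * (p^-1 + q^-1) = p * q by rewrite pq mulr1.
have -> : p * q * (p^-1 + q^-1) = q + p by field; rewrite pn qn.
by move=> e; lra.
Qed.

Lemma conjugate_mulB1l p q : 1 < p -> 1 < q -> p^-1 + q^-1 = 1 ->
  (p - 1) * q = p.
Proof. by move=> p1 q1 pq; have := conjugate_mulB1 p1 q1 pq; lra. Qed.

(** For [p < 2] the hypothesis raised to the power [q - 1 = 1/(p - 1)] is the
    same condition for the exponent [q] with [W] and [S] exchanged and constant
    [B ^ (1/(p - 1))], and then [sparse_mass] applies to it; this is the origin
    of the exponent [max 1 (1/(p - 1))]. *)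
Lemma node_bound p q B c W S WE SE (M : R) mE : 1 < p -> 1 < q ->
  p^-1 + q^-1 = 1 -> 0 <= c ->
  0 < W -> 0 < S -> 0 < WE -> 0 < SE -> 0 < M -> 0 <= mE ->
  WE <= W -> SE <= S -> M <= c * mE -> mE <= WE `^ p^-1 * SE `^ q^-1 ->
  W * S `^ (p - 1) <= B * M `^ p ->
  W * S / M <= c `^ (Num.max p q - 1) * B `^ (Num.max 1 (p - 1)^-1) *
    (WE `^ q^-1 * SE `^ p^-1).
Proof.
move=> p1 q1 pq c0 W0 S0 WE0 SE0 M0 mE0 WEW SES Mc mEh hB.
have p0 : 0 < p by lra.
have q0 : 0 < q by lra.
have pn : p != 0 by rewrite gt_eqF.
have qn : q != 0 by rewrite gt_eqF.
have pq' := conjugate_mulB1 p1 q1 pq.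
have iq : (p - 1)^-1 = q - 1.
  by apply: (mulfI (_ : p - 1 != 0)); [|rewrite divff]; rewrite ?gt_eqF//; lra.
have Mp0 : 0 < M `^ p by rewrite powR_gt0.
have B0 : 0 <= B.
  rewrite -(ler_pM2r Mp0) mul0r; apply: le_trans hB.
  by rewrite mulr_ge0 ?powR_ge0 ?(ltW W0).
case: (leP 2 p) => p2.
  have -> : Num.max p q = p by apply/max_idPl; nra.
  have -> : Num.max 1 (p - 1)^-1 = 1 by apply/max_idPl; rewrite iq; nra.
  rewrite (powRr1 B0).
  exact: (sparse_mass p2 q1 pq c0 B0 W0 S0 WE0 SE0 M0 mE0 SES Mc mEh hB).
have q2 : 2 <= q by nra.
have -> : Num.max p q = q by apply/max_idPr; nra.
have -> : Num.max 1 (p - 1)^-1 = q - 1.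
  by rewrite iq; apply/max_idPr; nra.
have qp : q^-1 + p^-1 = 1 by lra.
have hB' : S * W `^ (q - 1) <= B `^ (q - 1) * M `^ q.
  have -> : S * W `^ (q - 1) = (W * S `^ (p - 1)) `^ (q - 1).
    rewrite powRM ?powR_ge0 ?(ltW W0)// -powRrM pq' powRr1 ?(ltW S0)//.
    by rewrite mulrC.
  have -> : B `^ (q - 1) * M `^ q = (B * M `^ p) `^ (q - 1).
    rewrite powRM ?powR_ge0// -powRrM; congr (_ * _ `^ _).
    by move: pq'; nra.
  apply: ge0_ler_powR; rewrite ?nnegrE ?mulr_ge0 ?powR_ge0 ?(ltW W0)//; lra.
have mEh' : mE <= SE `^ q^-1 * WE `^ p^-1 by rewrite mulrC.
have := sparse_mass q2 p1 qp c0 (powR_ge0 B (q - 1)) S0 W0 SE0 WE0 M0 mE0 WEW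
  Mc mEh' hB'.
by rewrite [S * W]mulrC [SE `^ _ * _]mulrC.
Qed.

(** The norm estimate in terms of masses only, for the operator [T] of a tree of
    depth [n].  [Y] is the mass of [(T f)^p w], which duality (the last
    hypothesis) writes as the sum over the tree of [F G / M]; [G] is the mass of
    [(T f)^(p-1) w], and the [q]-th power of its density gives [Y] again.  Each
    Carleson sum is at most a constant times [X] or [Y], and [absorb_exponent]
    concludes. *)
Lemma tree_sparse_bound p q K n (F FE S SE X XE G GE W WE Y YE M : nat -> nat -> R) :
  1 < p -> 1 < q -> p^-1 + q^-1 = 1 -> 0 < K ->
  tree_additive F FE -> tree_additive S SE -> tree_additive X XE ->
  tree_additive G GE -> tree_additive W WE -> tree_additive Y YE ->
  (forall k i, 0 <= F k i) -> (forall k i, 0 <= G k i) ->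
  (forall k i, 0 < SE k i) -> (forall k i, 0 < S k i) ->
  (forall k i, 0 < WE k i) -> (forall k i, 0 < W k i) ->
  (forall k i c, 0 <= c ->
     p * c `^ (p - 1) * FE k i - (p - 1) * c `^ p * SE k i <= XE k i) ->
  (forall k i c, 0 <= c ->
     p * c `^ (p - 1) * F k i - (p - 1) * c `^ p * S k i <= X k i) ->
  (forall k i c, 0 <= c ->
     q * c `^ (q - 1) * GE k i - (q - 1) * c `^ q * WE k i <= YE k i) ->
  (forall k i c, 0 <= c ->
     q * c `^ (q - 1) * G k i - (q - 1) * c `^ q * W k i <= Y k i) ->
  (forall k i, W k i * S k i / M k i <=
     K * (WE k i `^ q^-1 * SE k i `^ p^-1)) ->
  Y 0 0 = tree_sum (fun k i => F k i * G k i / M k i) n 0 0 ->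
  Y 0 0 <= 2 / p * (2 `^ p / (p - 1)) * (2 * (2 `^ q / (q - 1)) / q) `^ (p - 1)
           * K `^ p * X 0 0.
Proof.
move=> p1 q1 pq K0 aF aS aX aG aW aY F0 G0 SE0 S0 WE0 W0 h1 h2 h3 h4 hK hY.
have D0 r : 1 < r -> 0 < 2 `^ r / (r - 1) :> R.
  by move=> r1; rewrite divr_gt0 ?powR_gt0//; lra.
apply: (absorb_exponent p1 q1 pq K0 (D0 _ q1)) => t t0.
have c1 := tree_carleson n 0 0 p1 aF aS aX F0 SE0 S0 h1 h2.
have c2 := tree_carleson n 0 0 q1 aG aW aY G0 WE0 W0 h3 h4.
have inv r A Z : 1 < r -> (r - 1) * 2 `^ (- r) * A <= Z ->
    A <= 2 `^ r / (r - 1) * Z :> R.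
  move=> r1; rewrite powRN; have r0 : 0 < r - 1 by lra.
  have e0 : (0 : R) < 2 `^ r by rewrite powR_gt0.
  rewrite -(@ler_pM2l _ (2 `^ r / (r - 1))) ?divr_gt0//.
  congr (_ <= _); field; rewrite gt_eqF//= gt_eqF//.
have {}c1 := inv _ _ _ p1 c1; have {}c2 := inv _ _ _ q1 c2.
set h1' := (fun k i => _) in c1; set h2' := (fun k i => _) in c2.
rewrite {1}hY.
have /le_trans : tree_sum (fun k i => F k i * G k i / M k i) n 0 0 <=
   tree_sum (fun k i => (K * (t `^ p / p)) * h1' k i +
                        (K * (t `^ (- q) / q)) * h2' k i) n 0 0.
  apply: le_tree_sum => k i.
  have S0' := S0 k i; have W0' := W0 k i.
  have -> : F k i * G k i / M k i =
     (F k i / S k i) * (G k i / W k i) * (W k i * S k i / M k i).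
    rewrite !mulrA; congr (_ * _); field; rewrite !gt_eqF//.
  have a0 : 0 <= F k i / S k i by rewrite divr_ge0// ltW.
  have b0 : 0 <= G k i / W k i by rewrite divr_ge0// ltW.
  have ab := mulr_ge0 a0 b0.
  apply: le_trans (ler_wpM2l ab (hK k i)) _.
  rewrite [leLHS]mulrCA -!mulrA -mulrDr ler_pM2l//.
  have := node_young p1 q1 pq a0 b0 (WE0 k i) (SE0 k i) t0.
  by rewrite -!mulrA.
apply; rewrite tree_sum_lin mulrDr.
have t1 : 0 <= K * (t `^ p / p).
  by rewrite mulr_ge0 ?divr_ge0 ?powR_ge0 ?(ltW K0)//; lra.
have t2 : 0 <= K * (t `^ (- q) / q).
  by rewrite mulr_ge0 ?divr_ge0 ?powR_ge0 ?(ltW K0)//; lra.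
by apply: lerD; rewrite [leRHS]mulrA ler_wpM2l.
Qed.

End weighted_node.

(** * Integrals of nonnegative functions *)

Section real_integral_facts.
Context d (T : measurableType d) {R : realType}.
Variable mu : {measure set T -> \bar R}.
Implicit Types (D : set T) (f g : T -> R).

Lemma le_integrableR D f g : measurable D -> measurable_fun D f ->
  (forall x, D x -> 0 <= f x <= g x) -> mu.-integrable D (EFin \o g) ->
  mu.-integrable D (EFin \o f).
Proof.
move=> mD mf fg; apply: le_integrable => //; first exact/measurable_EFinP.
move=> x Dx; have /andP[f0 fgx] := fg x Dx.
by rewrite /= lee_fin !ger0_norm// (le_trans f0).
Qed.

Lemma ge0_integrable D f : measurable_fun D f ->
  (forall x, D x -> 0 <= f x) ->
  (\int[mu]_(x in D) (f x)%:E < +oo)%E -> mu.-integrable D (EFin \o f).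
Proof.
move=> mf f0 foo; apply/integrableP; split; first exact/measurable_EFinP.
rewrite (eq_integral (EFin \o f))// => x /[!inE] Dx.
by rewrite /= ger0_norm// f0.
Qed.

Lemma le_Rintegral_subset (A D : set T) f : measurable A -> measurable D ->
  A `<=` D -> (forall x, D x -> 0 <= f x) -> mu.-integrable D (EFin \o f) ->
  \int[mu]_(x in A) f x <= \int[mu]_(x in D) f x.
Proof.
move=> mA mD AD f0 fi; have fiA := integrableS mD mA AD fi.
rewrite -lee_fin !fineK; [|exact: integrable_fin_num|exact: integrable_fin_num].
apply: ge0_subset_integral => //; exact: measurable_int fi.
Qed.

Lemma integral_EFin_Rintegral D f : measurable D -> mu.-integrable D (EFin \o f) ->
  (\int[mu]_(x in D) (f x)%:E = (\int[mu]_(x in D) f x)%:E)%E.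
Proof. by move=> mD fi; rewrite fineK//; exact: integrable_fin_num. Qed.

(** A nonnegative function of zero integral vanishes almost everywhere, which a
    positive function cannot do on a set of positive measure. *)
Lemma integral_gt0 D (f : T -> \bar R) : measurable D -> measurable_fun D f ->
  (forall x, D x -> 0 < f x)%E -> (0 < mu D)%E -> (0 < \int[mu]_(x in D) f x)%E.
Proof.
move=> mD mf f0 muD.
have h0 : (0 <= \int[mu]_(x in D) f x)%E.
  by apply: integral_ge0 => x /f0/ltW.
rewrite lt_neqAle h0 andbT; apply/negP => /eqP/esym I0.
have : (\int[mu]_(x in D) `|f x| = 0)%E.
  by rewrite -[RHS]I0; apply: eq_integral => x /[!inE] /f0/ltW f0x; rewrite gee0_abs.
move/(ae_eq_integral_abs mu mD mf) => [N [mN N0 hN]].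
have : (mu D <= mu N)%E.
  apply: le_measure; rewrite ?inE//.
  by apply: subset_trans hN => x Dx /= /(_ Dx)/eqP; rewrite gt_eqF// f0.
by rewrite N0 leNgt muD.
Qed.

Lemma Rintegral_gt0 D f : measurable D -> mu.-integrable D (EFin \o f) ->
  (forall x, D x -> 0 < f x) -> (0 < mu D)%E -> 0 < \int[mu]_(x in D) f x.
Proof.
move=> mD fi f0 muD; rewrite -lte_fin fineK; last exact: integrable_fin_num.
by apply: integral_gt0 => //; exact: measurable_int fi.
Qed.

End real_integral_facts.

(** * Positive dyadic operators on a measure space *)

Section positive_tree_operator.
Context d (T : measurableType d) {R : realType}.
Variable mu : {measure set T -> \bar R}.
(* In the application the [Q k i] are the dyadic boxes of the half-plane [X]
   and the [E k i] their upper halves. *)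
Variables (X : set T) (Q E : nat -> nat -> set T).
Hypothesis mX : measurable X.
Hypothesis mQ : forall k i, measurable (Q k i).
Hypothesis mE : forall k i, measurable (E k i).
Hypothesis QX : forall k i, Q k i `<=` X.
Hypothesis QE : forall k i, Q k i = E k i `|` Q k.+1 i.*2 `|` Q k.+1 i.*2.+1.
Hypothesis EQ0 : forall k i, E k i `&` (Q k.+1 i.*2 `|` Q k.+1 i.*2.+1) = set0.
Hypothesis QQ0 : forall k i, Q k.+1 i.*2 `&` Q k.+1 i.*2.+1 = set0.
Hypothesis muE : forall k i, (0 < mu (E k i))%E.

Let EQ k i : E k i `<=` Q k i.
Proof. by rewrite QE -setUA; exact: subsetUl. Qed.

Definition tree_operator (a : nat -> nat -> R) (n k i : nat) (z : T) : R :=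
  tree_sum (fun k i => \1_(Q k i) z * a k i) n k i.

Lemma tree_operatorS a n k i z : tree_operator a n.+1 k i z =
  \1_(Q k i) z * a k i + tree_operator a n k.+1 i.*2 z
  + tree_operator a n k.+1 i.*2.+1 z.
Proof. by []. Qed.

Lemma measurable_tree_operator a n k i (D : set T) :
  measurable_fun D (tree_operator a n k i).
Proof.
elim: n k i => [|n ih] k i; first exact: measurable_cst.
apply: measurable_funD; last exact: ih.
apply: measurable_funD; last exact: ih.
apply: measurable_funM => //; exact: measurable_indic.
Qed.

Lemma tree_operator_ge0 a n k i z : (forall k i, 0 <= a k i) ->
  0 <= tree_operator a n k i z.
Proof.
move=> a0; elim: n k i => [|n ih] k i//.
by rewrite tree_operatorS !addr_ge0// mulr_ge0// indicE.
Qed.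

Lemma tree_operator_le a n k i z : (forall k i, 0 <= a k i) ->
  tree_operator a n k i z <= tree_sum a n k i.
Proof.
move=> a0; apply: le_tree_sum => {}k {}i.
by rewrite indicE; case: (_ \in _); rewrite ?mul1r// mul0r.
Qed.

Lemma tree_additive_Rintegral (f : T -> R) :
  (forall k i, mu.-integrable (Q k i) (EFin \o f)) ->
  tree_additive (fun k i => \int[mu]_(x in Q k i) f x)
                (fun k i => \int[mu]_(x in E k i) f x).
Proof.
move=> fi k i; rewrite {1}QE -setUA Rintegral_setU//; last 3 first.
- exact: measurableU.
- by rewrite setUA -QE.
- by apply/disj_setPS; rewrite (EQ0 k i).
rewrite Rintegral_setU ?addrA//; last by apply/disj_setPS; rewrite (QQ0 k i).
apply: integrableS (fi k i) => //; first exact: measurableU.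
by rewrite (QE k i) -setUA; exact: subsetUr.
Qed.

(** The operator is formally self-adjoint: integrating against [h] replaces
    every indicator by the mass of [h] on the node. *)
Lemma Rintegral_tree_operator a (h : T -> R) (D : set T) n k i :
  measurable D -> mu.-integrable D (EFin \o h) -> Q k i `<=` D ->
  (forall k i, 0 <= a k i) ->
  mu.-integrable D (EFin \o (fun z => tree_operator a n k i z * h z)) /\
  \int[mu]_(z in D) (tree_operator a n k i z * h z) =
  tree_sum (fun k i => a k i * \int[mu]_(z in Q k i) h z) n k i.
Proof.
move=> mD hi QD a0; elim: n k i QD => [|n ih] k i QD.
  split.
    apply: eq_integrable (integrable0 mu D) => // z _ /=.
    by rewrite /tree_operator /= mul0r.
  rewrite (@eq_Rintegral _ _ _ mu D (fun=> 0)); last first.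
    by move=> z _; rewrite /tree_operator /= mul0r.
  by rewrite Rintegral_cst// mul0r.
have [QD1 QD2] : Q k.+1 i.*2 `<=` D /\ Q k.+1 i.*2.+1 `<=` D.
  by split; apply: subset_trans QD; rewrite (QE k i); [move=> z; left; right|exact: subsetUr].
have [i1 e1] := ih _ _ QD1; have [i2 e2] := ih _ _ QD2.
have ihr : mu.-integrable D (EFin \o (h \_ (Q k i))).
  rewrite -restrict_EFin; apply/integrable_restrict => //.
  by apply: integrableS hi => //; exact: measurableI.
have i0 : mu.-integrable D (EFin \o (fun z => a k i * (h \_ (Q k i)) z)).
  apply: (@integrableZl _ _ _ mu D mD (a k i) (EFin \o (h \_ (Q k i)))).
  exact: ihr.
have e0 : \int[mu]_(z in D) (a k i * (h \_ (Q k i)) z) =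
    a k i * \int[mu]_(z in Q k i) h z.
  rewrite RintegralZl//.
  by rewrite -Rintegral_mkcondr setIidr.
have E3 : (fun z => tree_operator a n.+1 k i z * h z) =
    (fun z => (a k i * (h \_ (Q k i)) z + tree_operator a n k.+1 i.*2 z * h z)
      + tree_operator a n k.+1 i.*2.+1 z * h z).
  apply/funext => z; rewrite tree_operatorS !mulrDl; congr (_ + _ + _).
  rewrite indicE patchE; case: (_ \in _); rewrite ?mul1r// !mul0r mulr0//.
rewrite E3; split.
  exact: (@integrableD _ _ _ mu D mD _ _ (@integrableD _ _ _ mu D mD _ _ i0 i1) i2).
rewrite RintegralD//; last exact: (@integrableD _ _ _ mu D mD _ _ i0 i1).
by rewrite RintegralD// e0 e1 e2.
Qed.

Variables (p q : R) (w r f : T -> R).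
Hypothesis p1 : 1 < p.
Hypothesis q1 : 1 < q.
Hypothesis pq : p^-1 + q^-1 = 1.
Hypothesis mw : measurable_fun X w.
Hypothesis mr : measurable_fun X r.
Hypothesis mf : measurable_fun X f.
Hypothesis w0 : forall x, X x -> 0 < w x.
Hypothesis r0 : forall x, X x -> 0 < r x.
Hypothesis f0 : forall x, X x -> 0 <= f x.

(* [r] is the density of the reference measure, [s] the dual weight of [w] *)
Let s x := w x `^ (1 - q).
Let u x := w x * r x.
Let v x := s x * r x.
Let phi x := f x * r x.
Let psi x := f x `^ p * w x * r x.

Hypothesis iu : forall k i, mu.-integrable (Q k i) (EFin \o u).
Hypothesis iv : forall k i, mu.-integrable (Q k i) (EFin \o v).
Hypothesis ipsi : forall k i, mu.-integrable (Q k i) (EFin \o psi).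

Let pq_mul : (p - 1) * (q - 1) = 1 := conjugate_mulB1 p1 q1 pq.

Let s_gt0 x : X x -> 0 < s x.
Proof. by move=> Xx; rewrite powR_gt0// w0. Qed.

(* The density of [f] with respect to [s] has the same [p]-norm as [f] with
   respect to [w]; this is why the dual weight appears. *)
Let ws x : X x -> (f x / s x) `^ p * s x = f x `^ p * w x.
Proof.
move=> Xx; have wx0 := w0 Xx.
have sx0 := ltW (s_gt0 Xx).
rewrite (powRM _ (f0 Xx)) ?invr_ge0//.
rewrite -mulrA; congr (_ * _).
rewrite -powR_inv1// -powRrM -{2}(powRr1 sx0) -powRD; last first.
  by rewrite (gt_eqF (s_gt0 Xx)) implybT.
rewrite /s -powRrM.
have -> : (1 - q) * (-1 * p + 1) = 1.
  by rewrite -[RHS]pq_mul; ring.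
by rewrite powRr1// ltW.
Qed.

Let tangent_phi c x : X x -> 0 <= c ->
  p * c `^ (p - 1) * phi x - (p - 1) * c `^ p * v x <= psi x.
Proof.
move=> Xx c0; rewrite /phi /v /psi -(ws Xx) !mulrA -mulrBl ler_pM2r ?r0//.
exact: tangent_perspective (f0 Xx) (s_gt0 Xx) c0.
Qed.

Let mpow (h : T -> R) (a : R) (D : set T) : measurable_fun D h ->
  measurable_fun D (fun x => h x `^ a).
Proof.
by move=> mh; exact: (measurableT_comp (measurable_powR a) mh).
Qed.

(** The tangent at [1] bounds [f] by [f^p w] plus a multiple of [s], both
    integrable on boxes. *)
Lemma integrable_sparse_input k i : mu.-integrable (Q k i) (EFin \o phi).
Proof.
have QXki := QX (k:=k) (i:=i).
have ig : mu.-integrable (Q k i) (EFin \o (fun x => psi x + (p - 1) * v x)).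
  apply: (@integrableD _ _ _ mu (Q k i) (mQ k i) (EFin \o psi)
    (EFin \o (fun x => (p - 1) * v x))) => //.
  exact: (@integrableZl _ _ _ mu (Q k i) (mQ k i) (p - 1) (EFin \o v)).
apply: le_integrableR ig => //.
  by apply: measurable_funM; exact: measurable_funS mX QXki _.
move=> x /QXki Xx.
have ph0 : 0 <= phi x by rewrite mulr_ge0 ?f0// ltW// r0.
rewrite ph0 /=; have := tangent_phi Xx ler01.
rewrite !powR1 !mulr1 lerBlDr => h; apply: le_trans h.
by rewrite ler_peMl// ltW.
Qed.

Variables (M : nat -> nat -> R) (B c : R).
Hypothesis M0 : forall k i, 0 < M k i.
Hypothesis c0 : 0 <= c.
Hypothesis ir : forall k i, mu.-integrable (Q k i) (EFin \o r).
Hypothesis Mc : forall k i, M k i <= c * \int[mu]_(x in E k i) r x.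
Hypothesis hB : forall k i, \int[mu]_(x in Q k i) u x *
  (\int[mu]_(x in Q k i) v x) `^ (p - 1) <= B * M k i `^ p.

Definition sparse_operator n :=
  tree_operator (fun k i => (\int[mu]_(x in Q k i) phi x) / M k i) n 0 0.

Definition sparse_const : R :=
  2 / p * (2 `^ p / (p - 1)) * (2 * (2 `^ q / (q - 1)) / q) `^ (p - 1).

Lemma sparse_const_ge0 : 0 <= sparse_const.
Proof.
rewrite /sparse_const mulr_ge0 ?powR_ge0// mulr_ge0//.
  by rewrite divr_ge0// ltW// (lt_trans ltr01).
by rewrite divr_ge0 ?powR_ge0// subr_ge0 ltW.
Qed.

(** The weighted norm inequality.  All masses are genuine integrals here, so
    the hypotheses of [tree_sparse_bound] hold by integrating pointwise
    inequalities over [Q k i] and [E k i].  Since the operator of a finite tree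
    is bounded by the constant [L], the quantity to be absorbed is finite. *)
Lemma sparse_operator_bound n :
  let K := c `^ (Num.max p q - 1) * B `^ (Num.max 1 (p - 1)^-1) in
  mu.-integrable (Q 0 0) (EFin \o (fun z => sparse_operator n z `^ p * u z)) /\
  \int[mu]_(z in Q 0 0) (sparse_operator n z `^ p * u z) <=
  sparse_const * K `^ p * \int[mu]_(z in Q 0 0) psi z.
Proof.
move=> K; have iphi := integrable_sparse_input.
pose F k i := \int[mu]_(x in Q k i) phi x.
pose a k i := F k i / M k i.
have F_ge0 k i : 0 <= F k i.
  apply: Rintegral_ge0 => x /QX Xx; rewrite mulr_ge0 ?f0//.
  by rewrite ltW// r0.
have a0 k i : 0 <= a k i by rewrite divr_ge0// ltW.
pose tf := sparse_operator n.
have tf0 z : 0 <= tf z by exact: tree_operator_ge0.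
pose L := tree_sum a n 0 0.
have tfL z : tf z <= L by exact: tree_operator_le.
pose g z := tf z `^ (p - 1).
have g0 z : 0 <= g z by exact: powR_ge0.
have p10 : 0 <= p - 1 by rewrite subr_ge0 ltW.
have mtf D : measurable_fun D tf by exact: measurable_tree_operator.
have u0 x : X x -> 0 < u x by move=> Xx; rewrite mulr_gt0 ?w0 ?r0.
have v0 x : X x -> 0 < v x by move=> Xx; rewrite mulr_gt0 ?s_gt0 ?r0.
have mu_ D : D `<=` X -> measurable_fun D u.
  by move=> DX; apply: measurable_funM; exact: measurable_funS mX DX _.
(* [e = p - 1] gives [g u], and [e = p] gives [g^q u] *)
have ipow e : 0 <= e -> forall k i,
    mu.-integrable (Q k i) (EFin \o (fun z => tf z `^ e * u z)).
  move=> e0 k i.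
  have ig : mu.-integrable (Q k i) (EFin \o (fun x => L `^ e * u x)).
    exact: (@integrableZl _ _ _ mu (Q k i) (mQ k i) (L `^ e) (EFin \o u)).
  apply: le_integrableR ig => //.
    apply: measurable_funM; [exact: mpow|exact/mu_/QX].
  move=> x /QX Xx; rewrite mulr_ge0 ?powR_ge0 ?(ltW (u0 _ Xx))//=.
  rewrite ler_wpM2r ?(ltW (u0 _ Xx))//.
  by apply: ge0_ler_powR; rewrite ?nnegrE// (le_trans (tf0 x)).
have pge0 : 0 <= p by rewrite ltW// (lt_trans ltr01).
split; first exact: ipow.
pose G k i := \int[mu]_(x in Q k i) (g x * u x).
pose GE k i := \int[mu]_(x in E k i) (g x * u x).
have igu k i := ipow _ p10 k i.
have ip k i := ipow p pge0 k i.
have isub (h : T -> R) : (forall k i, mu.-integrable (Q k i) (EFin \o h)) ->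
    forall k i, mu.-integrable (E k i) (EFin \o h).
  by move=> ih k i; apply: integrableS (ih k i) => //; exact: EQ.
have EX k i : E k i `<=` X by apply: subset_trans (@QX k i); exact: EQ.
have posE (h : T -> R) : (forall x, X x -> 0 < h x) ->
    (forall k i, mu.-integrable (Q k i) (EFin \o h)) ->
    forall k i, 0 < \int[mu]_(x in E k i) h x.
  move=> h0 ih k i; apply: Rintegral_gt0 => //; first exact: isub.
  by move=> x /EX; exact: h0.
have muQ k i : (0 < mu (Q k i))%E.
  by apply: lt_le_trans (muE k i) _; apply: le_measure; rewrite ?inE//; exact: EQ.
have posQ (h : T -> R) : (forall x, X x -> 0 < h x) ->
    (forall k i, mu.-integrable (Q k i) (EFin \o h)) ->
    forall k i, 0 < \int[mu]_(x in Q k i) h x.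
  move=> h0 ih k i; apply: Rintegral_gt0 => //.
  by move=> x /QX; exact: h0.
(* tangent inequalities integrate, whatever the exponent and the set *)
have lin (r' : R) (A : set T) (h1 h2 h3 : T -> R) : measurable A -> A `<=` X ->
   mu.-integrable A (EFin \o h1) ->
   mu.-integrable A (EFin \o h2) -> mu.-integrable A (EFin \o h3) ->
   (forall x c', X x -> 0 <= c' ->
     r' * c' `^ (r' - 1) * h1 x - (r' - 1) * c' `^ r' * h2 x <= h3 x) ->
   forall c', 0 <= c' -> r' * c' `^ (r' - 1) * \int[mu]_(x in A) h1 x
     - (r' - 1) * c' `^ r' * \int[mu]_(x in A) h2 x <= \int[mu]_(x in A) h3 x.
  move=> mA AX i1 i2 i3 h c' c'0.
  have j1 := @integrableZl _ _ _ mu A mA (r' * c' `^ (r' - 1)) _ i1.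
  have j2 := @integrableZl _ _ _ mu A mA ((r' - 1) * c' `^ r') _ i2.
  rewrite -!RintegralZl// -RintegralB//.
  apply: le_Rintegral => //.
    exact: (@integrableB _ _ _ mu A mA _ _ j1 j2).
  by move=> x /AX Xx; exact: h.
have tang2 x c' : X x -> 0 <= c' ->
    q * c' `^ (q - 1) * (g x * u x) - (q - 1) * c' `^ q * u x <= tf x `^ p * u x.
  move=> Xx c'0; have -> : tf x `^ p = g x `^ q.
    by rewrite /g -powRrM; rewrite (conjugate_mulB1l p1 q1 pq).
  rewrite mulrA -mulrBl ler_pM2r ?u0//.
  exact: tangent_powR.
have iYE : forall k i, mu.-integrable (Q k i) (EFin \o (fun z => tf z `^ p * u z)) := ip.
have K0 : 0 < K.
  have mE0 : 0 < \int[mu]_(x in E 0%N 0%N) r x by apply: posE.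
  have c1 : 0 < c.
    rewrite -(pmulr_lgt0 _ mE0).
    exact: lt_le_trans (Mc _ _).
  have B0 : 0 < B.
    rewrite -(@pmulr_lgt0 _ (M 0%N 0%N `^ p)) ?powR_gt0//.
    apply: lt_le_trans (hB 0 0).
    by rewrite mulr_gt0 ?powR_gt0// posQ.
  by rewrite mulr_gt0 ?powR_gt0.
pose W k i := \int[mu]_(x in Q k i) u x.
pose S k i := \int[mu]_(x in Q k i) v x.
have key := @tree_sparse_bound R p q K n F (fun k i => \int[mu]_(x in E k i) phi x)
  S (fun k i => \int[mu]_(x in E k i) v x)
  (fun k i => \int[mu]_(x in Q k i) psi x) (fun k i => \int[mu]_(x in E k i) psi x)
  G GE W (fun k i => \int[mu]_(x in E k i) u x)
  (fun k i => \int[mu]_(x in Q k i) (tf x `^ p * u x))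
  (fun k i => \int[mu]_(x in E k i) (tf x `^ p * u x)) M p1 q1 pq K0.
apply: key.
- exact: tree_additive_Rintegral.
- exact: tree_additive_Rintegral.
- exact: tree_additive_Rintegral.
- exact: tree_additive_Rintegral.
- exact: tree_additive_Rintegral.
- exact: tree_additive_Rintegral.
- by [].
- by move=> k i; apply: Rintegral_ge0 => x /QX Xx; rewrite mulr_ge0// ltW// u0.
- exact: posE.
- exact: posQ.
- exact: posE.
- exact: posQ.
- move=> k i; apply: lin; [exact: mE|exact: EX|exact: isub|exact: isub|exact: isub|].
  by move=> x c' Xx; exact: tangent_phi.
- move=> k i; apply: lin; [exact: mQ|exact: QX|exact: integrable_sparse_input|exact: iv|exact: ipsi|].
  by move=> x c' Xx; exact: tangent_phi.
- move=> k i; apply: lin; [exact: mE|exact: EX|exact: isub|exact: isub|exact: isub|].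
  by move=> x c' Xx; exact: tang2.
- move=> k i; apply: lin; [exact: mQ|exact: QX|exact: igu|exact: iu|exact: ip|].
  by move=> x c' Xx; exact: tang2.
- move=> k i; apply: (@node_bound R p q B c _ _ _ _ _ (\int[mu]_(x in E k i) r x)).
  all: try by []; try exact: posE; try exact: posQ.
  + by rewrite ltW// posE.
  + rewrite /W (tree_additive_Rintegral iu k i) -addrA lerDl addr_ge0// ltW// posQ//.
  + rewrite /S (tree_additive_Rintegral iv k i) -addrA lerDl addr_ge0// ltW// posQ//.
  + apply: (@mass_hoelder R p q) => //; [exact: posE|exact: posE|] => t t0.
    have iu' := isub u iu k i; have iv' := isub v iv k i.
    have j1 := @integrableZl _ _ _ mu _ (mE k i) (t `^ q^-1 / p) _ iu'.
    have j2 := @integrableZl _ _ _ mu _ (mE k i) (t `^ (- p^-1) / q) _ iv'.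
    rewrite ![_ * _ / _]mulrAC -!RintegralZl// -RintegralD//.
    apply: le_Rintegral => //; first exact: isub.
      exact: (@integrableD _ _ _ mu _ (mE k i) _ _ j1 j2).
    move=> x /EX Xx.
    rewrite /u /v !mulrA -mulrDl ler_peMl ?(ltW (r0 Xx))//.
    have := @weighted_amgm R p q t (w x) (s x) p1 q1 pq t0 (ltW (w0 Xx)) (ltW (s_gt0 Xx)).
    rewrite ![_ * _ / _]mulrAC; apply: le_trans.
    rewrite /s -powRrM -powRD ?(gt_eqF (w0 Xx)) ?implybT//.
    rewrite (_ : p^-1 + _ = 0) ?powRr0//.
    by rewrite mulrBl mul1r divff ?addrA ?pq ?subrr// gt_eqF// (lt_trans ltr01 q1).
  + exact: hB.
(* duality: [tf^p u] is [tf] tested against [g u] *)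
- have [_ e] := Rintegral_tree_operator n (mQ 0 0) (igu 0 0) (@subset_refl _ _) a0.
  have -> : (fun k i => F k i * G k i / M k i) =
      (fun k i => a k i * \int[mu]_(z in Q k i) (g z * u z)).
    by apply/funext => k; apply/funext => i; rewrite mulrAC.
  rewrite -e; apply: eq_Rintegral => z _.
  by rewrite mulrA /g -/tf -(mulr_powRB1 (tf0 z) (lt_trans ltr01 p1)).
Qed.

End positive_tree_operator.

(** * Integrals of powers of the height *)

Section power_mass.
Context {R : realType}.
Notation mu := (@lebesgue_measure R).
Notation area := ((@lebesgue_measure R) \x (@lebesgue_measure R))%E.
Implicit Types (a b l alpha : R).

Lemma continuous_powR alpha (x : R) : 0 < x ->
  {for x, continuous (fun y : R => y `^ alpha)}.
Proof.
move=> x0; apply: differentiable_continuous; apply/derivable1_diffP.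
by apply: derivable_powR; rewrite in_itv/= x0.
Qed.

Lemma integral_powR_cc a b alpha : 0 < a -> a <= b -> -1 < alpha ->
  (\int[mu]_(y in `[a, b]) (y `^ alpha)%:E =
   ((b `^ (1 + alpha) - a `^ (1 + alpha)) / (1 + alpha))%:E)%E.
Proof.
move=> a0; rewrite le_eqVlt => /predU1P[<- _|ab al].
  by rewrite set_itv1 integral_set1 subrr mul0r.
have al0 : 1 + alpha != 0 by rewrite gt_eqF//; lra.
pose F : R -> R := (1 + alpha)^-1 \*: (fun y : R => y `^ (1 + alpha)).
have dF (x : R) : 0 < x -> is_derive x 1 F (x `^ alpha).
  move=> x0; have h := is_derive1_powR (1 + alpha) x0.
  have -> : x `^ alpha = (1 + alpha)^-1 *: ((1 + alpha) * x `^ (1 + alpha - 1)).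
    by rewrite /GRing.scale /= mulrA mulVf// mul1r; congr (_ `^ _); lra.
  exact: is_deriveZ.
have cF (x : R) : 0 < x -> {for x, continuous F}.
  move=> x0; apply: differentiable_continuous; apply/derivable1_diffP.
  by have [] := dF _ x0.
rewrite (@continuous_FTC2 _ (fun y => y `^ alpha) F a b)//.
- by rewrite -EFinB /F /GRing.scale /= -mulrBr mulrC.
- apply: continuous_in_subspaceT => x; rewrite inE/= in_itv/= => /andP[ax _].
  by apply: continuous_powR; exact: lt_le_trans ax.
- split.
  + move=> x; rewrite in_itv/= => /andP[ax _].
    by have [] := dF _ (lt_trans a0 ax).
  + by apply: cvg_at_right_filter; exact: cF.
  + by apply: cvg_at_left_filter; apply: cF; exact: lt_trans ab.
- move=> x; rewrite in_itv/= => /andP[ax _].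
  by rewrite derive1E; have [_ ->] := dF _ (lt_trans a0 ax).
Qed.

Lemma measurable_powRD alpha (D : set R) : measurable_fun D (fun y : R => y `^ alpha).
Proof. by apply: (measurable_funS measurableT) => //; exact: measurable_powR. Qed.

(** For negative [alpha] the integrand is singular at [0]; the integral is the
    monotone limit of those over [[l / (n + 1), l]]. *)
Lemma integral_powR_oc l alpha : 0 < l -> -1 < alpha ->
  (\int[mu]_(y in `]0%R, l]) (y `^ alpha)%:E =
   (l `^ (1 + alpha) / (1 + alpha))%:E)%E.
Proof.
move=> l0 al.
pose A n := `[l / n.+1%:R, l]%classic.
have An n : 0 < l / n.+1%:R by rewrite divr_gt0.
have UA : \bigcup_n A n = `]0%R, l]%classic.
  apply/seteqP; split=> [x [n _]|x] /=; rewrite /A /= !in_itv/=.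
    by move=> /andP[h ->]; rewrite andbT; exact: lt_le_trans h.
  move=> /andP[x0 xl].
  have [n hn] : exists n : nat, l / x <= n%:R.
    exists (Num.truncn (l / x)).+1; rewrite ltW//.
    by have /andP[] := @truncn_itv R (l/x) (ltW (divr_gt0 l0 x0)).
  exists n => //; rewrite /A /= in_itv/= xl andbT.
  rewrite ler_pdivrMr// mulrC -ler_pdivrMr//; apply: le_trans hn _.
  by rewrite ler_nat.
have ndA : nondecreasing_seq A.
  apply/nondecreasing_seqP => n; apply/subsetPset => x.
  rewrite /A /= !in_itv/= => /andP[h ->]; rewrite andbT; apply: le_trans h.
  by rewrite ler_pM2l// lef_pV2 ?posrE// ler_nat.
have H : (\int[mu]_(y in A n) (y `^ alpha)%:E @[n --> \oo] -->
    \int[mu]_(y in `]0%R, l]) (y `^ alpha)%:E)%E.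
  rewrite -UA; apply: ge0_nondecreasing_set_cvg_integral => //.
  - by move=> n; exact: measurable_itv.
  - by move=> n; apply/measurable_EFinP; exact: measurable_powRD.
  - by move=> n x _; rewrite lee_fin powR_ge0.
have E n : (\int[mu]_(y in A n) (y `^ alpha)%:E)%E =
    ((l `^ (1 + alpha) - (l / n.+1%:R) `^ (1 + alpha)) / (1 + alpha))%:E.
  rewrite /A integral_powR_cc ?An//.
  by rewrite ler_pdivrMr// ler_peMr ?ler1n// ltW.
rewrite {}(funext E) in H; apply: (cvg_unique _ H) => //.
apply: cvg_EFin; first by near=> n.
have h : (l / n.+1%:R) `^ (1 + alpha) @[n --> \oo] --> (0 : R).
  have al0 : 0 < 1 + alpha by lra.
  have H0 := (cvg_at_rightP (fun x : R => x `^ (1 + alpha)) 0 0).1 (powR_cvg0 al0).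
  apply: (H0 (fun n => l / n.+1%:R)); split; first exact: An.
  rewrite -[X in _ --> X](mulr0 l).
  apply: cvgMr; exact: cvg_harmonic.
have h2 : l `^ (1 + alpha) - (l / n.+1%:R) `^ (1 + alpha) @[n --> \oo] -->
    l `^ (1 + alpha).
  by rewrite -[X in _ --> X]subr0; apply: cvgB => //; exact: cvg_cst.
exact: cvgMl h2.
Unshelve. all: by end_near. Qed.

Lemma integral_rectangle (I J : set R) (h : R -> R) :
  measurable I -> measurable J -> measurable_fun setT h -> (forall y, 0 <= h y) ->
  (\int[area]_(z in I `*` J) (h z.2)%:E = mu I * \int[mu]_(y in J) (h y)%:E)%E.
Proof.
move=> mI mJ mh h0.
have mIJ : measurable (I `*` J) by exact: measurableX.
rewrite integral_mkcond fubini_tonelli1//; last first.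
- by move=> z; apply: erestrict_ge0 => ? _; rewrite lee_fin.
- apply/(measurable_restrictT _ mIJ).
  apply/measurable_EFinP; apply: (measurable_funS measurableT) => //.
  exact: (measurableT_comp mh measurable_snd).
have mhE : measurable_fun J (fun y => (h y)%:E).
  by apply/measurable_EFinP; exact: (measurable_funS measurableT).
transitivity (\int[mu]_(x in I) (\int[mu]_(y in J) (h y)%:E))%E.
  rewrite [RHS]integral_mkcond; apply: eq_integral => x _.
  rewrite /fubini_F patchE; case: ifPn => xI.
    rewrite [RHS]integral_mkcond; apply: eq_integral => y _.
    by rewrite !patchE in_setX xI.
  rewrite integral0_eq// => y _.
  by rewrite patchE in_setX (negbTE xI).
have c0 : (0 <= \int[mu]_(y in J) (h y)%:E)%E.
  by apply: integral_ge0 => y _; rewrite lee_fin.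
by rewrite integral_cst// muleC.
Qed.

End power_mass.

(** * Dyadic boxes and their masses *)

Section dyadic_boxes.
Context {R : realType}.
Notation mu := (@lebesgue_measure R).
Notation area := ((@lebesgue_measure R) \x (@lebesgue_measure R))%E.
Implicit Types (a L alpha : R) (k i : nat).

(** Intervals are half-open so that siblings are disjoint; the boxes omit the
    real axis and thus lie inside the half-plane. *)
Definition dyadic_interval a L k i : set R :=
  `[a + L / 2 ^+ k * i%:R, a + L / 2 ^+ k * i.+1%:R[%classic.
Definition dyadic_box a L k i : set (R * R) :=
  dyadic_interval a L k i `*` `]0, L / 2 ^+ k]%classic.
Definition dyadic_top a L k i : set (R * R) :=
  dyadic_interval a L k i `*` `]L / 2 ^+ k / 2, L / 2 ^+ k]%classic.

Lemma measurable_dyadic_box a L k i : measurable (dyadic_box a L k i).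
Proof. by apply: measurableX; exact: measurable_itv. Qed.

Lemma measurable_dyadic_top a L k i : measurable (dyadic_top a L k i).
Proof. by apply: measurableX; exact: measurable_itv. Qed.

Lemma measurable_halfplane : measurable (@halfplane R).
Proof.
rewrite (_ : halfplane = setT `*` `]0, +oo[%classic).
  by apply: measurableX => //; exact: measurable_itv.
by apply/seteqP; split=> z /=; rewrite /halfplane /= in_itv/= andbT// => -[].
Qed.

Lemma dyadic_box_halfplane a L k i : dyadic_box a L k i `<=` halfplane.
Proof. by move=> z [_] /=; rewrite in_itv/= => /andP[]. Qed.

Lemma side_succ L k : L / 2 ^+ k.+1 = L / 2 ^+ k / 2.
Proof. by rewrite exprSr invfM mulrA. Qed.

Lemma side_gt0 L k : 0 < L -> 0 < L / 2 ^+ k.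
Proof. by move=> L0; rewrite divr_gt0// exprn_gt0. Qed.

Lemma dyadic_box_split a L k i : 0 < L ->
  dyadic_box a L k i = dyadic_top a L k i `|` dyadic_box a L k.+1 i.*2
    `|` dyadic_box a L k.+1 i.*2.+1.
Proof.
move=> L0; have l0 := side_gt0 k L0.
rewrite /dyadic_box /dyadic_top /dyadic_interval side_succ.
set l := L / 2 ^+ k.
have e1 : i.*2%:R = 2 * i%:R :> R by rewrite -mul2n natrM.
have e2 : i.*2.+1%:R = 2 * i%:R + 1 :> R by rewrite -natr1 e1.
have e3 : i.*2.+2%:R = 2 * i%:R + 2 :> R by rewrite -natr1 e2; lra.
have e4 : i.+1%:R = i%:R + 1 :> R by rewrite -natr1.
rewrite e2 e3 e1 e4.
apply/seteqP; split=> [[x y] /=|[x y] /=]; rewrite !in_itv/=.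
  move=> [/andP[h1 h2] /andP[h3 h4]].
  case: (ltP (l / 2) y) => h5; first by left; left; rewrite h1 h2 h4.
  case: (ltP x (a + l / 2 * (2 * i%:R + 1))) => h6; [left; right|right].
    by split; apply/andP; split => //; lra.
  by split; apply/andP; split => //; lra.
case=> [[|]|] [/andP[h1 h2] /andP[h3 h4]]; split; apply/andP; split; try lra.
Qed.

Lemma dyadic_top_disjoint a L k i : 0 < L ->
  dyadic_top a L k i `&` (dyadic_box a L k.+1 i.*2
    `|` dyadic_box a L k.+1 i.*2.+1) = set0.
Proof.
move=> L0; rewrite /dyadic_box /dyadic_top side_succ.
apply/seteqP; split=> [[x y] /=|//]; rewrite !in_itv/=.
by move=> [[_ /andP[h1 _]]] [[_ /andP[_ h2]]|[_ /andP[_ h2]]];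
  move: h1; rewrite ltNge h2.
Qed.

Lemma dyadic_sibling_disjoint a L k i :
  dyadic_box a L k.+1 i.*2 `&` dyadic_box a L k.+1 i.*2.+1 = set0.
Proof.
apply/seteqP; split=> [[x y]|//].
rewrite /dyadic_box /dyadic_interval /= !in_itv/=.
by move=> [[/andP[_ h1] _]] [/andP[h2 _] _]; move: h1; rewrite ltNge h2.
Qed.

Lemma measure_dyadic_interval a L k i : 0 < L ->
  mu (dyadic_interval a L k i) = (L / 2 ^+ k)%:E.
Proof.
move=> L0; have l0 := side_gt0 k L0.
rewrite /dyadic_interval lebesgue_measure_itv/= lte_fin ltrD2l ltr_pM2l// ltr_nat.
by rewrite ltnSn -EFinB -natr1; congr EFin; ring.
Qed.

Lemma powR_side alpha (l : R) : 0 < l -> l * l `^ (1 + alpha) = l `^ (2 + alpha).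
Proof.
move=> l0; rewrite -{1}(powRr1 (ltW l0)) -powRD ?(gt_eqF l0) ?implybT//.
by congr (_ `^ _); lra.
Qed.

Lemma box_mass_gt0 alpha (l : R) : -1 < alpha -> 0 < l ->
  0 < l `^ (2 + alpha) / (1 + alpha).
Proof. by move=> al l0; rewrite divr_gt0 ?powR_gt0//; lra. Qed.

Lemma mass_dyadic_box alpha a L k i : -1 < alpha -> 0 < L ->
  (\int[area]_(z in dyadic_box a L k i) (z.2 `^ alpha)%:E =
  ((L / 2 ^+ k) `^ (2 + alpha) / (1 + alpha))%:E)%E.
Proof.
move=> al L0; have l0 := side_gt0 k L0.
rewrite (@integral_rectangle _ _ _ (fun y => y `^ alpha)); last 4 first.
- exact: measurable_itv.
- exact: measurable_itv.
- exact: measurable_powR.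
- by move=> y; exact: powR_ge0.
rewrite [X in (X * _)%E]measure_dyadic_interval// integral_powR_oc// -EFinM.
by rewrite mulrA powR_side.
Qed.

(** The mass of the upper half is a fraction of the mass of the box that
    depends on [alpha] only, and [-1 < alpha] makes this fraction positive. *)
Lemma mass_dyadic_top alpha a L k i : -1 < alpha -> 0 < L ->
  (\int[area]_(z in dyadic_top a L k i) (z.2 `^ alpha)%:E =
  ((1 - 2 `^ (- (1 + alpha))) *
   ((L / 2 ^+ k) `^ (2 + alpha) / (1 + alpha)))%:E)%E.
Proof.
move=> al L0; have l0 := side_gt0 k L0.
rewrite (@integral_rectangle _ _ _ (fun y => y `^ alpha)); last 4 first.
- exact: measurable_itv.
- exact: measurable_itv.
- exact: measurable_powR.
- by move=> y; exact: powR_ge0.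
rewrite [X in (X * _)%E]measure_dyadic_interval//.
rewrite integral_itv_obnd_cbnd; last first.
  by apply/measurable_EFinP; exact: measurable_powRD.
rewrite integral_powR_cc//; [|lra|lra].
have h2 : 2^-1 `^ (1 + alpha) = 2 `^ (- (1 + alpha)).
  by rewrite -powR_inv1// -powRrM mulN1r.
rewrite -EFinM -powR_side// (powRM _ (ltW l0))// h2.
by congr EFin; ring.
Qed.

Lemma carleson_box_halfplane (u v : R) : carleson_box u v `&` halfplane =
  `[u, v]%classic `*` `]0, v - u]%classic.
Proof.
apply/seteqP; split=> [[x y]|[x y]]; rewrite /carleson_box /halfplane /= !in_itv/=.
  by move=> [[-> /andP[_ ->]] ->].
by move=> [-> /andP[y0 ->]]; rewrite (ltW y0).
Qed.

Lemma mass_carleson_box alpha (u v : R) : -1 < alpha -> u < v ->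
  int_dA alpha (carleson_box u v) (fun=> 1%E) =
  ((v - u) `^ (2 + alpha) / (1 + alpha))%:E.
Proof.
move=> al uv; have l0 : 0 < v - u by lra.
rewrite /int_dA carleson_box_halfplane.
under eq_integral do rewrite mul1e.
rewrite (@integral_rectangle _ _ _ (fun y => y `^ alpha)); last 4 first.
- exact: measurable_itv.
- exact: measurable_itv.
- exact: measurable_powR.
- by move=> y; exact: powR_ge0.
rewrite integral_powR_oc// lebesgue_measure_itv/= lte_fin uv -EFinB -EFinM.
by rewrite mulrA powR_side.
Qed.

End dyadic_boxes.

(** * Bekolle weights on boxes *)

Section bekolle_to_sparse.
Context {R : realType}.
Notation mu := (@lebesgue_measure R).
Notation area := ((@lebesgue_measure R) \x (@lebesgue_measure R))%E.
Variables (p alpha : R) (w : R * R -> R).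
Hypothesis p1 : 1 < p.
Hypothesis al : -1 < alpha.
Hypothesis bw : bekolle_weight p alpha w.

Let q := conjugate_exponent p.
Let B := fine (bekolle_cst p alpha w).

Lemma conjugateP : p^-1 + q^-1 = 1.
Proof. by rewrite /q /conjugate_exponent invrK addrC subrK. Qed.

Lemma conjugate_gt1 : 1 < q.
Proof.
have p0 : 0 < p by rewrite (lt_trans ltr01).
have h : 0 < 1 - p^-1 by rewrite subr_gt0 invf_lt1.
by rewrite /q /conjugate_exponent invf_gt1// gtrBl invr_gt0.
Qed.

Lemma area_rectangle (I J : set R) : measurable I -> measurable J ->
  area (I `*` J) = (mu I * mu J)%E.
Proof. by move=> mI mJ; exact: product_measure1E. Qed.

Lemma area_dyadic_top_gt0 a L k i : 0 < L -> (0 < area (dyadic_top a L k i))%E.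
Proof.
move=> L0; have l0 := side_gt0 k L0.
rewrite area_rectangle; [|exact: measurable_itv|exact: measurable_itv].
rewrite [X in (X * _)%E]measure_dyadic_interval// lebesgue_measure_itv/= lte_fin.
have h : L / 2 ^+ k / 2 < L / 2 ^+ k by lra.
by rewrite h -EFinB -EFinM lte_fin mulr_gt0// subr_gt0.
Qed.

Lemma area_carleson_box_gt0 (u v : R) : u < v ->
  (0 < area (carleson_box u v `&` halfplane))%E.
Proof.
move=> uv.
rewrite carleson_box_halfplane area_rectangle//.
rewrite !lebesgue_measure_itv/= !lte_fin uv subr_gt0 uv -!EFinB -EFinM lte_fin.
by rewrite subr0 mulr_gt0// subr_gt0.
Qed.

Lemma measurable_weight : measurable_fun halfplane w.
Proof. by have [_ []] := bw. Qed.

Lemma weight_gt0 z : halfplane z -> 0 < w z.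
Proof. by have [h _ _] := bw; exact: h. Qed.

Lemma measurable_fun_powR_comp (D : set (R * R)) (h : R * R -> R) (e : R) :
  measurable_fun D h -> measurable_fun D (fun z => h z `^ e).
Proof. by move=> mh; exact: (measurableT_comp (measurable_powR e) mh). Qed.

Lemma measurable_density (D : set (R * R)) (e : R) :
  measurable_fun D (fun z : R * R => z.2 `^ e).
Proof.
apply: measurable_fun_powR_comp; apply: measurable_funS measurable_snd => //.
Qed.

Lemma measurable_carleson_box (u v : R) : measurable (carleson_box u v).
Proof. by apply: measurableX; exact: measurable_itv. Qed.

Lemma int_dA_gt0 (h : R * R -> R) (u v : R) : u < v ->
  measurable_fun halfplane h -> (forall z, halfplane z -> 0 < h z) ->
  (0 < int_dA alpha (carleson_box u v) (fun z => (h z)%:E))%E.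
Proof.
move=> uv mh h0; apply: integral_gt0.
- apply: measurableI; [exact: measurable_carleson_box|exact: measurable_halfplane].
- under eq_fun do rewrite -EFinM.
  apply/measurable_EFinP; apply: measurable_funM; last exact: measurable_density.
  apply: (measurable_funS measurable_halfplane) => //; exact: subIsetr.
- move=> z [_ Hz]; rewrite -EFinM lte_fin mulr_gt0 ?h0//.
  by rewrite powR_gt0.
- exact: area_carleson_box_gt0.
Qed.

Lemma measurable_dual_weight : measurable_fun halfplane (dual_weight p w).
Proof. by apply: measurable_fun_powR_comp; exact: measurable_weight. Qed.

Lemma dual_weight_gt0 z : halfplane z -> 0 < dual_weight p w z.
Proof. by move=> /weight_gt0; exact: powR_gt0. Qed.

(** Finiteness of both masses follows from finiteness of their product, as
    neither factor vanishes. *)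
Lemma bekolle_box (u v : R) : u < v ->
  let W := int_dA alpha (carleson_box u v) (fun z => (w z)%:E) in
  let S := int_dA alpha (carleson_box u v) (fun z => (dual_weight p w z)%:E) in
  [/\ W \is a fin_num, S \is a fin_num &
   fine W * fine S `^ (p - 1) <= B * ((v - u) `^ (2 + alpha) / (1 + alpha)) `^ p].
Proof.
move=> uv W S.
have W0 : (0 < W)%E by apply: int_dA_gt0; [|exact: measurable_weight|exact: weight_gt0].
have S0 : (0 < S)%E.
  by apply: int_dA_gt0; [|exact: measurable_dual_weight|exact: dual_weight_gt0].
set M := (v - u) `^ (2 + alpha) / (1 + alpha).
have M0 : 0 < M by rewrite box_mass_gt0 ?subr_gt0.
have Minv : (0 < M^-1%:E)%E by rewrite lte_fin invr_gt0.
have [_ _ Bfin] := bw.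
have le_sup : (W * M^-1%:E * (S * M^-1%:E) `^ (p - 1) <= bekolle_cst p alpha w)%E.
  apply: ereal_sup_ubound; exists u, v; split => //.
  rewrite /box_average !mass_carleson_box// -/M.
  by rewrite inver (gt_eqF M0).
have lt_sup := le_lt_trans le_sup Bfin.
have WM0 : (0 < W * M^-1%:E)%E by rewrite mule_gt0.
have SM0 : (0 < S * M^-1%:E)%E by rewrite mule_gt0.
have SMp0 : (0 < (S * M^-1%:E) `^ (p - 1))%E by rewrite poweR_gt0.
have Wfin : W \is a fin_num.
  rewrite ge0_fin_numE ?(ltW W0)// ltNge leye_eq; apply/negP => /eqP Wy.
  by move: lt_sup; rewrite Wy gt0_mulye// gt0_mulye// ltxx.
have Sfin : S \is a fin_num.
  rewrite ge0_fin_numE ?(ltW S0)// ltNge leye_eq; apply/negP => /eqP Sy.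
  move: lt_sup; rewrite Sy gt0_mulye// poweRyr ?gt0_muley// ?ltxx//.
  by rewrite gt_eqF// subr_gt0.
split => //.
have B0 : (0 <= bekolle_cst p alpha w)%E.
  by apply: le_trans le_sup; rewrite mule_ge0// ltW.
have Bf : bekolle_cst p alpha w = B%:E.
  by rewrite /B fineK// ge0_fin_numE.
have s0 : 0 < fine S by rewrite fine_gt0// S0 -ge0_fin_numE// ltW.
have eW : (W * M^-1%:E = (fine W * M^-1)%:E)%E by rewrite EFinM fineK.
have eS : (S * M^-1%:E = (fine S * M^-1)%:E)%E by rewrite EFinM fineK.
move: le_sup; rewrite Bf eW eS poweR_EFin -EFinM lee_fin.
have Mi : M^-1 `^ (p - 1) = (M `^ (p - 1))^-1.
  by rewrite -powR_inv1 ?(ltW M0)// -powRrM mulN1r powRN.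
rewrite (powRM _ (ltW s0)) ?invr_ge0 ?(ltW M0)// Mi.
rewrite mulrACA -invfM (mulr_powRB1 (ltW M0) (lt_trans ltr01 p1)).
by rewrite ler_pdivrMr// powR_gt0.
Qed.

(** Nonnegativity of the supremum needs one box; the unit one is used. *)
Lemma bekolle_cstE : bekolle_cst p alpha w = B%:E.
Proof.
have [_ _ Bfin] := bw.
rewrite /B fineK// ge0_fin_numE//.
have [Wf Sf _] := bekolle_box ltr01.
apply: (@le_trans _ _ (box_average alpha w (carleson_box 0 1) *
         box_average alpha (dual_weight p w) (carleson_box 0 1) `^ (p - 1))%E).
  rewrite mule_ge0 ?poweR_ge0// /box_average mass_carleson_box// inver.
  rewrite gt_eqF ?box_mass_gt0 ?subr0//.
  rewrite mule_ge0//.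
    by apply/ltW/int_dA_gt0; [exact: ltr01|exact: measurable_weight|exact: weight_gt0].
  by rewrite lee_fin invr_ge0 ltW// box_mass_gt0.
by apply: ereal_sup_ubound; exists 0, 1; split => //; exact: ltr01.
Qed.

End bekolle_to_sparse.

(** * Dyadic operators of the half-plane *)

Section halfplane_sparse.
Context {R : realType}.
Notation mu := (@lebesgue_measure R).
Notation area := ((@lebesgue_measure R) \x (@lebesgue_measure R))%E.
Variables (p alpha : R) (w f : R * R -> R).
Hypothesis p1 : 1 < p.
Hypothesis al : -1 < alpha.
Hypothesis bw : bekolle_weight p alpha w.
Hypothesis mf : measurable_fun halfplane f.
Hypothesis f0 : forall z, halfplane z -> 0 <= f z.
Hypothesis fi : area.-integrable halfplane
  (EFin \o (fun z => f z `^ p * w z * z.2 `^ alpha)).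

Let q := conjugate_exponent p.
Let B := fine (bekolle_cst p alpha w).
(* a box over its upper half, in mass *)
Let top_ratio : R := (1 - 2 `^ (- (1 + alpha)))^-1.

Definition box_mass (L : R) (k : nat) : R :=
  (L / 2 ^+ k) `^ (2 + alpha) / (1 + alpha).

(** The positive operator [\sum_Q 1_Q F_Q / M_Q] over the [n] first generations
    of boxes below the box of side [L] with left end [a]. *)
Definition dyadic_operator a L n : R * R -> R :=
  sparse_operator area (dyadic_box a L) (fun z => z.2 `^ alpha) f
    (fun k _ => box_mass L k) n.

Definition weighted_const : R :=
  sparse_const p q * (top_ratio `^ (Num.max p q - 1)) `^ p.

Lemma weighted_const_ge0 : 0 <= weighted_const.
Proof. by rewrite /weighted_const mulr_ge0 ?powR_ge0 ?sparse_const_ge0. Qed.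

Lemma dyadic_box_carleson (a L : R) k i : dyadic_box a L k i `<=`
  carleson_box (a + L / 2 ^+ k * i%:R) (a + L / 2 ^+ k * i.+1%:R) `&`
  (@halfplane R).
Proof.
have e : a + L / 2 ^+ k * i.+1%:R - (a + L / 2 ^+ k * i%:R) = L / 2 ^+ k.
  by rewrite -natr1; ring.
move=> [x y]; rewrite /dyadic_box /dyadic_interval /carleson_box /halfplane /=.
rewrite e !in_itv/= => -[/andP[-> /ltW ->] /andP[y0 ->]].
by rewrite y0 ltW.
Qed.

Lemma integrable_dyadic_box (h : R * R -> R) (a L : R) (k i : nat) : 0 < L ->
  measurable_fun halfplane h -> (forall z, halfplane z -> 0 <= h z) ->
  let u := a + L / 2 ^+ k * i%:R in let v := a + L / 2 ^+ k * i.+1%:R in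
  let J := int_dA alpha (carleson_box u v) (fun z => (h z)%:E) in
  J \is a fin_num ->
  area.-integrable (dyadic_box a L k i) (EFin \o (fun z => h z * z.2 `^ alpha)) /\
  \int[area]_(z in dyadic_box a L k i) (h z * z.2 `^ alpha) <= fine J.
Proof.
move=> L0 mh h0 u v J Jfin.
have mQ : measurable (carleson_box u v `&` halfplane).
  by apply: measurableI; [exact: measurable_carleson_box|exact: measurable_halfplane].
have mhr (D : set (R * R)) : D `<=` halfplane ->
    measurable_fun D (fun z => h z * z.2 `^ alpha).
  move=> DH; apply: measurable_funM; last exact: measurable_density.
  exact: (measurable_funS measurable_halfplane).
have ge0 z : halfplane z -> 0 <= h z * z.2 `^ alpha.
  by move=> Hz; rewrite mulr_ge0 ?h0 ?powR_ge0.
have Ji : area.-integrable (carleson_box u v `&` halfplane)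
    (EFin \o (fun z => h z * z.2 `^ alpha)).
  apply: ge0_integrable; first by apply: mhr; exact: subIsetr.
    by move=> z [_]; exact: ge0.
  by rewrite -ge0_fin_numE//; apply: integral_ge0 => z [_ Hz]; rewrite lee_fin ge0.
have QC := @dyadic_box_carleson a L k i.
have iQ : area.-integrable (dyadic_box a L k i)
    (EFin \o (fun z => h z * z.2 `^ alpha)).
  by apply: (integrableS _ _ _ Ji) => //; exact: measurable_dyadic_box.
split => //; rewrite -lee_fin /Rintegral !fineK//; last first.
  by apply: integrable_fin_num => //; exact: measurable_dyadic_box.
rewrite /J /int_dA; apply: ge0_subset_integral => //.
- exact: measurable_dyadic_box.
- by apply/measurable_EFinP; apply: mhr; exact: subIsetr.
- by move=> z [_ Hz]; rewrite lee_fin ge0.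
Qed.

Lemma top_ratio_gt0 : 0 < 1 - 2 `^ (- (1 + alpha)) :> R.
Proof.
have al1 : 0 < 1 + alpha by rewrite addrC -ltrBlDr sub0r.
have h : 1 < 2 `^ (1 + alpha) :> R.
  by rewrite /powR pnatr_eq0/= expR_gt1 mulr_gt0// ln_gt0// ltr1n.
by rewrite subr_gt0 powRN invf_lt1// powR_gt0.
Qed.

(** The closed Carleson box over a dyadic interval contains the dyadic box
    and has the same mass, so the weight condition passes to dyadic boxes by
    monotonicity ([integrable_dyadic_box]).  The constant is independent of the
    root and of the depth of the tree. *)
Lemma dyadic_operator_bound (a L : R) n : 0 < L ->
  area.-integrable (dyadic_box a L 0 0)
    (EFin \o (fun z => dyadic_operator a L n z `^ p * (w z * z.2 `^ alpha))) /\
  \int[area]_(z in dyadic_box a L 0 0)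
    (dyadic_operator a L n z `^ p * (w z * z.2 `^ alpha)) <=
  weighted_const * (B `^ Num.max 1 (p - 1)^-1) `^ p *
    \int[area]_(z in halfplane) (f z `^ p * w z * z.2 `^ alpha).
Proof.
move=> L0.
have w0 := weight_gt0 bw.
have mw := measurable_weight bw.
have v0 : forall z, halfplane z -> 0 < dual_weight p w z := dual_weight_gt0 bw.
have mv : measurable_fun halfplane (dual_weight p w) := measurable_dual_weight bw.
have uv k i : a + L / 2 ^+ k * i%:R < a + L / 2 ^+ k * i.+1%:R.
  by rewrite ltrD2l ltr_pM2l ?side_gt0// ltr_nat.
have side k i : a + L / 2 ^+ k * i.+1%:R - (a + L / 2 ^+ k * i%:R) = L / 2 ^+ k.
  by rewrite -natr1; ring.
have HW k i := bekolle_box p1 al bw (uv k i).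
have iW k i : area.-integrable (dyadic_box a L k i)
    (EFin \o (fun z => w z * z.2 `^ alpha)).
  have [W1 _ _] := HW k i.
  by have [] := integrable_dyadic_box L0 mw (fun z Hz => ltW (w0 z Hz)) W1.
have iS k i : area.-integrable (dyadic_box a L k i)
    (EFin \o (fun z => dual_weight p w z * z.2 `^ alpha)).
  have [_ S1 _] := HW k i.
  by have [] := integrable_dyadic_box L0 mv (fun z Hz => ltW (v0 z Hz)) S1.
have ir k i : area.-integrable (dyadic_box a L k i)
    (EFin \o (fun z : R * R => z.2 `^ alpha)).
  apply: ge0_integrable; first exact: measurable_density.
    by move=> z _; exact: powR_ge0.
  by rewrite mass_dyadic_box// ltry.
have mbox := @measurable_dyadic_box R a L.
have ipsi k i : area.-integrable (dyadic_box a L k i)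
    (EFin \o (fun z => f z `^ p * w z * z.2 `^ alpha)).
  apply: (integrableS _ _ _ fi); [exact: measurable_halfplane|
    exact: measurable_dyadic_box|exact: dyadic_box_halfplane].
have hB k i : \int[area]_(z in dyadic_box a L k i) (w z * z.2 `^ alpha) *
    (\int[area]_(z in dyadic_box a L k i) (dual_weight p w z * z.2 `^ alpha)) `^ (p - 1)
    <= B * box_mass L k `^ p.
  have [W1 S1] := HW k i; rewrite side; apply: le_trans.
  have [_ lW] := integrable_dyadic_box L0 mw (fun z Hz => ltW (w0 z Hz)) W1.
  have [_ lS] := integrable_dyadic_box L0 mv (fun z Hz => ltW (v0 z Hz)) S1.
  have S0 : 0 <= \int[area]_(z in dyadic_box a L k i) (dual_weight p w z * z.2 `^ alpha).
    apply: Rintegral_ge0 => z /dyadic_box_halfplane Hz.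
    by rewrite mulr_ge0 ?powR_ge0 ?ltW ?v0.
  apply: ler_pM.
  - apply: Rintegral_ge0 => z /dyadic_box_halfplane Hz.
    by rewrite mulr_ge0 ?powR_ge0 ?ltW ?w0.
  - exact: powR_ge0.
  - exact: lW.
  - by apply: ge0_ler_powR; rewrite ?nnegrE ?subr_ge0 ?(ltW p1)// (le_trans S0 lS).
have Mc k i : box_mass L k <=
    top_ratio * \int[area]_(z in dyadic_top a L k i) (z.2 `^ alpha).
  rewrite /Rintegral mass_dyadic_top//= mulrA mulVf ?mul1r//.
  by rewrite gt_eqF// top_ratio_gt0.
have c0 : 0 <= top_ratio by rewrite /top_ratio invr_ge0 ltW// top_ratio_gt0.
have [H1 H2] := @sparse_operator_bound _ _ R area halfplane (dyadic_box a L)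
  (dyadic_top a L) measurable_halfplane mbox (@measurable_dyadic_top R a L)
  (@dyadic_box_halfplane R a L) (fun k i => dyadic_box_split a k i L0)
  (fun k i => dyadic_top_disjoint a k i L0) (@dyadic_sibling_disjoint R a L)
  (fun k i => area_dyadic_top_gt0 a k i L0) p q w (fun z => z.2 `^ alpha) f
  p1 (conjugate_gt1 p1) (conjugateP p) mw (measurable_density alpha) mf w0
  (fun z Hz => powR_gt0 alpha Hz) f0 iW iS ipsi (fun k _ => box_mass L k) B top_ratio
  (fun k _ => box_mass_gt0 al (side_gt0 k L0)) c0 ir Mc hB n.
split; first exact: H1.
apply: le_trans H2 _.
rewrite powRM ?powR_ge0// mulrA -/weighted_const ler_wpM2l//.
  by rewrite mulr_ge0 ?powR_ge0// weighted_const_ge0.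
rewrite -lee_fin !fineK; last 2 first.
- by apply: (integrable_fin_num _ fi); exact: measurable_halfplane.
- by apply: (integrable_fin_num _ (ipsi _ _)); exact: measurable_dyadic_box.
apply: ge0_subset_integral => //.
- exact: measurable_dyadic_box.
- exact: measurable_halfplane.
- by apply: measurable_int fi.
- move=> z Hz; rewrite lee_fin mulr_ge0 ?powR_ge0// mulr_ge0 ?powR_ge0//.
  by rewrite ltW// w0.
- exact: dyadic_box_halfplane.
Qed.

Lemma integrable_dyadic_input (a L : R) k i : 0 < L ->
  area.-integrable (dyadic_box a L k i) (EFin \o (fun z => f z * z.2 `^ alpha)).
Proof.
move=> L0.
have w0 := weight_gt0 bw.
have v0 : forall z, halfplane z -> 0 < dual_weight p w z := dual_weight_gt0 bw.
have mv : measurable_fun halfplane (dual_weight p w) := measurable_dual_weight bw.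
have uv j m : a + L / 2 ^+ j * m%:R < a + L / 2 ^+ j * m.+1%:R.
  by rewrite ltrD2l ltr_pM2l ?side_gt0// ltr_nat.
have HW j m := bekolle_box p1 al bw (uv j m).
have iS j m : area.-integrable (dyadic_box a L j m)
    (EFin \o (fun z => dual_weight p w z * z.2 `^ alpha)).
  have [_ S1 _] := HW j m.
  by have [] := integrable_dyadic_box L0 mv (fun z Hz => ltW (v0 z Hz)) S1.
have ipsi j m : area.-integrable (dyadic_box a L j m)
    (EFin \o (fun z => f z `^ p * w z * z.2 `^ alpha)).
  apply: (integrableS _ _ _ fi); [exact: measurable_halfplane|
    exact: measurable_dyadic_box|exact: dyadic_box_halfplane].
exact: (@integrable_sparse_input _ _ R area halfplane (dyadic_box a L)
  measurable_halfplane (@measurable_dyadic_box R a L)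
  (@dyadic_box_halfplane R a L) p q w (fun z => z.2 `^ alpha) f
  p1 (conjugate_gt1 p1) (conjugateP p) (measurable_density alpha) mf w0
  (fun z Hz => powR_gt0 alpha Hz) f0 iS ipsi).
Qed.

End halfplane_sparse.

(** * Two dyadic trees *)

Section two_trees.
Context {R : realType}.
Implicit Types (a L x D : R) (k n i : nat) (h : nat -> nat -> R).

(** Children double the index, so the descendants of [(k0, i0)] after [j]
    generations are the [(k0 + j, i0 2^j + r)] with [r < 2^j]. *)
Lemma tree_sum_ge_node h n k i : (forall k i, 0 <= h k i) -> (k < n)%N ->
  (i < 2 ^ k)%N -> h k i <= tree_sum h n 0 0.
Proof.
move=> h0.
suff H m k0 i0 j r : (j < m)%N -> (r < 2 ^ j)%N ->
    h (k0 + j)%N (i0 * 2 ^ j + r)%N <= tree_sum h m k0 i0.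
  by move=> kn ik; have := H n 0%N 0%N k i kn ik; rewrite add0n mul0n add0n.
have ts0 m' k' i' : 0 <= tree_sum h m' k' i'.
  by elim: m' k' i' => //= m' ih k' i'; rewrite !addr_ge0.
elim: m k0 i0 j r => // m ih k0 i0 [|j] r jm /=.
  rewrite expn0 ltnS leqn0 => /eqP ->.
  by rewrite addn0 muln1 addn0 -addrA lerDl addr_ge0.
rewrite ltnS in jm; rewrite expnS => hr.
have [r1|r1] := ltnP r (2 ^ j).
  have := ih k0.+1 i0.*2 j r jm r1.
  rewrite addSnnS -muln2 -mulnA => H.
  by apply: (le_trans H); rewrite muln2 -addrA addrCA lerDl addr_ge0.
have r2 : (r - 2 ^ j < 2 ^ j)%N by rewrite ltn_subLR// addnn -mul2n.
have := ih k0.+1 i0.*2.+1 j (r - 2 ^ j)%N jm r2.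
rewrite addSnnS.
have -> : (i0.*2.+1 * 2 ^ j + (r - 2 ^ j) = i0 * (2 * 2 ^ j) + r)%N.
  by rewrite mulSn -addnA addnCA subnKC// -muln2 mulnA.
by move=> H; apply: (le_trans H); rewrite lerDr addr_ge0.
Qed.

Lemma dyadic_intervalP a L k x : 0 < L -> a <= x ->
  dyadic_interval a L k (Num.truncn ((x - a) / (L / 2 ^+ k))) x.
Proof.
move=> L0 ax; have l0 := side_gt0 k L0.
have h : 0 <= (x - a) / (L / 2 ^+ k) by rewrite divr_ge0 ?subr_ge0// ltW.
have /andP[h1 h2] := truncn_itv h.
rewrite /dyadic_interval /= in_itv/= -lerBrDl -ltrBlDl.
by rewrite mulrC -ler_pdivlMr// h1/= mulrC -ltr_pdivrMr.
Qed.

Lemma dyadic_index_lt a L k i x : 0 < L -> dyadic_interval a L k i x ->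
  x < a + L -> (i < 2 ^ k)%N.
Proof.
move=> L0; have l0 := side_gt0 k L0.
rewrite /dyadic_interval /= in_itv/= => /andP[h _] xL.
rewrite -(ltr_nat R) natrX -(ltr_pM2l l0).
by rewrite divfK ?gt_eqF ?exprn_gt0//; lra.
Qed.

Lemma neq_truncn x x' : 0 <= x -> x <= x' -> Num.truncn x != Num.truncn x' ->
  x < (Num.truncn x')%:R <= x'.
Proof.
move=> x0 xx' ne.
have /andP[h1 h2] := truncn_itv x0.
have /andP[h3 h4] := truncn_itv (le_trans x0 xx').
rewrite h3 andbT; apply: lt_le_trans h2 _; rewrite ler_nat.
by rewrite ltn_neqAle ne/= le_truncn.
Qed.

(** Both grids have mesh [3 N / 2^k] and are offset by [N], which is [2^k / 3]
    meshes.  If [x] and [x'] were separated in both, there would be an endpoint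
    of each grid within [N / 2^k], a third of the mesh, of the other; then
    [2^k / 3] would be at distance less than [1/3] from an integer, that is, be
    an integer. *)
Lemma one_third_trick (N : R) k x x' : 0 < N -> - N <= x -> - N <= x' ->
  `|x - x'| <= N / 2 ^+ k ->
  exists (a : R) i, [/\ a = - (2 * N) \/ a = - N,
    dyadic_interval a (3 * N) k i x & dyadic_interval a (3 * N) k i x'].
Proof.
move=> N0.
wlog xx' : x x' / x <= x'.
  move=> H xN xN' d; have [h|/ltW h] := leP x x'; first exact: H.
  rewrite distrC in d; have [a [i [h1 h2 h3]]] := H _ _ h xN' xN d.
  by exists a, i; split.
move=> xN xN'; rewrite distrC ger0_norm ?subr_ge0// => d.
have L0 : 0 < 3 * N by rewrite mulr_gt0.
have l0 := side_gt0 k L0.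
pose l := 3 * N / 2 ^+ k.
pose a0 := - (2 * N); pose a1 := - N.
have a0x : a0 <= x by rewrite /a0; lra.
have a0x' : a0 <= x' by rewrite /a0; lra.
have I0 := dyadic_intervalP k L0 a0x; have I0' := dyadic_intervalP k L0 a0x'.
have I1 := dyadic_intervalP k L0 xN; have I1' := dyadic_intervalP k L0 xN'.
have [e0|ne0] := eqVneq (Num.truncn ((x - a0) / l)) (Num.truncn ((x' - a0) / l)).
  exists a0, (Num.truncn ((x - a0) / l)); split; [by left|exact: I0|].
  by rewrite e0; exact: I0'.
have [e1|ne1] := eqVneq (Num.truncn ((x - a1) / l)) (Num.truncn ((x' - a1) / l)).
  exists a1, (Num.truncn ((x - a1) / l)); split; [by right|exact: I1|].
  by rewrite e1; exact: I1'.
exfalso.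
have dv a : a <= x -> 0 <= (x - a) / l /\ (x - a) / l <= (x' - a) / l.
  by move=> ax; rewrite divr_ge0 ?subr_ge0 ?(ltW l0)// ler_pM2r ?invr_gt0// lerD2r.
have [p0 q0] := dv _ a0x; have [p1 q1] := dv _ xN.
have := neq_truncn p0 q0 ne0; have := neq_truncn p1 q1 ne1.
set m0 := Num.truncn ((x' - - N) / l); set m1 := Num.truncn ((x' - a0) / l).
rewrite -/a1 => /andP[b1 b2] /andP[b3 b4].
have E : (x - a0) / l = (x - a1) / l + 2 ^+ k / 3.
  rewrite /a0 /a1 /l; field.
  by rewrite ?expf_neq0 ?gt_eqF ?exprn_gt0.
have E' : (x' - a0) / l = (x' - a1) / l + 2 ^+ k / 3.
  rewrite /a0 /a1 /l; field.
  by rewrite ?expf_neq0 ?gt_eqF ?exprn_gt0.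
have d' : (x' - a1) / l <= (x - a1) / l + 3^-1.
  rewrite -lerBlDl -mulrBl ler_pdivrMr//.
  apply: le_trans (_ : N / 2 ^+ k <= _); first by move: d; rewrite /a1; lra.
  by rewrite /l; lra.
(* multiplied by 3, the endpoints become integers at distance less than one,
   hence equal *)
have t3 m : (3 * m)%N%:R = 3 * m%:R :> R by rewrite natrM.
have c1 : (3 * m1)%N%:R < (3 * m0 + 2 ^ k + 1)%N%:R :> R.
  by rewrite natrD ?[(_ + 2 ^ k)%:R]natrD !t3 natrX; lra.
have c2 : (3 * m0 + 2 ^ k)%N%:R < (3 * m1 + 1)%N%:R :> R.
  by rewrite natrD ?[(_ + 2 ^ k)%:R]natrD !t3 natrX; lra.
rewrite !ltr_nat !addn1 !ltnS in c1 c2.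
have e : (3 * m1 = 3 * m0 + 2 ^ k)%N by apply/eqP; rewrite eqn_leq c1 c2.
have : (3 %| 2 ^ k)%N by rewrite -(@dvdn_addr (3 * m0) 3) ?dvdn_mulr// -e dvdn_mulr.
by rewrite Euclid_dvdX.
Qed.

(** An exhaustion of the half-plane by compact rectangles; with half-width
    [(N + 1) / 2] and height [N + 1] they lie in both root boxes, of side
    [3 (N + 1)]. *)
Definition truncated_region (N : nat) : set (R * R) :=
  `[- (N.+1%:R / 2), N.+1%:R / 2]%classic `*` `[N.+1%:R^-1, N.+1%:R]%classic.

(** At this depth a third of the side of a box is below [1 / (N + 1)], the least
    height in the truncated region. *)
Definition tree_depth (N : nat) : nat := (N.+1 ^ 2).+1.

(** The generation is the last one whose side [3 (N + 1) / 2^k] is at least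
    [3 D]: this is large enough for [one_third_trick] and for the heights, and
    below [6 D]. *)
Lemma common_dyadic_box N (z xi : R * R) D :
  truncated_region N z -> truncated_region N xi ->
  `|z.1 - xi.1| <= D -> z.2 <= D -> xi.2 <= D ->
  exists (a : R) k i,
    [/\ a = - (2 * N.+1%:R) \/ a = - N.+1%:R, (k < tree_depth N)%N, (i < 2 ^ k)%N,
     dyadic_box a (3 * N.+1%:R) k i z /\ dyadic_box a (3 * N.+1%:R) k i xi &
     3 * N.+1%:R / 2 ^+ k <= 6 * D].
Proof.
case: z xi => [x y] [x' y'].
rewrite /truncated_region /= !in_itv/= => -[/andP[x1 x2] /andP[hy1 hy2]].
move=> [/andP[x1' x2'] /andP[hy1' hy2']] hD yD yD'.
set M : R := N.+1%:R.
have M1 : 1 <= M by rewrite /M ler1n.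
have M0 : 0 < M by lra.
have L0 : 0 < 3 * M by lra.
have y0 : 0 < y by apply: lt_le_trans hy1; rewrite invr_gt0.
have y0' : 0 < y' by apply: lt_le_trans hy1'; rewrite invr_gt0.
have D0 : 0 < D by lra.
rewrite -/M in x1 x2 x1' x2'.
have box a k i : dyadic_interval a (3 * M) k i x -> dyadic_interval a (3 * M) k i x' ->
    y <= 3 * M / 2 ^+ k -> y' <= 3 * M / 2 ^+ k ->
    dyadic_box a (3 * M) k i (x, y) /\ dyadic_box a (3 * M) k i (x', y').
  by move=> ? ? ? ?; split; split => //=; rewrite in_itv/=; apply/andP.
(* for large [D] the root box will do *)
have [DM|MD] := leP D M; last first.
  exists (- (2 * M)), 0%N, 0%N; split => //; [by left| |by rewrite expr0; lra].
  by apply: box; rewrite /dyadic_interval /= ?in_itv/= expr0; lra.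
have bigP : M < D * 2 ^+ (N.+1 ^ 2).+1.
  have h : M * M < 2 ^+ (N.+1 ^ 2).+1.
    rewrite /M -natrM -natrX ltr_nat mulnn.
    by apply: (ltn_trans (ltn_expl _ (isT : (1 < 2)%N))); rewrite ltn_exp2l.
  rewrite -ltr_pdivrMr ?exprn_gt0//.
  apply: lt_le_trans (_ : M^-1 <= _); last by apply: le_trans yD.
  by rewrite ltr_pdivrMr ?exprn_gt0// mulrC ltr_pdivlMr.
have exP : exists k, M < D * 2 ^+ k.+1 by exists (N.+1 ^ 2)%N.
have [k kP kmin] := ex_minnP exP.
have kN : (k <= N.+1 ^ 2)%N by apply: kmin; exact: bigP.
have kD : D <= M / 2 ^+ k.
  case: k kP kmin {kN} => [|k] kP kmin; first by rewrite expr0 divr1.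
  rewrite leNgt; apply/negP => h.
  suff : (k < k)%N by rewrite ltnn.
  by apply: kmin; rewrite -ltr_pdivrMr ?exprn_gt0.
have [a [i [ha i1 i2]]] : exists (a : R) i, [/\ a = - (2 * M) \/ a = - M,
    dyadic_interval a (3 * M) k i x & dyadic_interval a (3 * M) k i x'].
  apply: one_third_trick => //; [lra|lra|exact: le_trans hD kD].
have lk : M / 2 ^+ k <= 3 * M / 2 ^+ k.
  by rewrite ler_pM2r ?invr_gt0 ?exprn_gt0//; lra.
exists a, k, i; split => //.
- apply: (dyadic_index_lt L0 i1); case: ha => ->; lra.
- by apply: box => //; apply: le_trans lk; apply: le_trans kD.
- rewrite exprS in kP; rewrite ler_pdivrMr ?exprn_gt0//.
  by move: kP; set t := 2 ^+ k; lra.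
Qed.

End two_trees.

(** * Measurability of parametric integrals *)

Section parametric_integral.
Context d1 d2 (T1 : measurableType d1) (T2 : measurableType d2) {R : realType}.
Variable m2 : {sigma_finite_measure set T2 -> \bar R}.

(** Tonelli on a rectangle: the integrand is extended by zero, since the
    measurability theorem is about functions on the whole product. *)
Lemma measurable_parametric_integral (E : set T1) (D : set T2)
    (G : T1 -> T2 -> \bar R) : measurable E -> measurable D ->
  measurable_fun (E `*` D) (fun z => G z.1 z.2) ->
  (forall x y, E x -> D y -> 0 <= G x y)%E ->
  measurable_fun E (fun x => \int[m2]_(y in D) G x y)%E.
Proof.
move=> mE mD mG G0.
pose H := (fun z => G z.1 z.2) \_ (E `*` D).
have mED : measurable (E `*` D) by exact: measurableX.
have mH : measurable_fun setT H by exact/(measurable_restrictT _ mED).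
have H0 z : (0 <= H z)%E.
  by apply: erestrict_ge0 => -[x y] [/= Ex Dy]; exact: G0.
have mF := @measurable_fun_fubini_tonelli_F _ _ _ _ _ m2 H mH H0.
apply: (eq_measurable_fun (fubini_F m2 H)); last exact: measurable_funS mF.
move=> x xE; rewrite /fubini_F [RHS]integral_mkcond; apply: eq_integral => y _.
by rewrite /H !patchE in_setX/= xE.
Qed.

End parametric_integral.

(** * The modulus of the Bergman kernel *)

Section kernel.
Context {R : realType}.
Notation area := ((@lebesgue_measure R) \x (@lebesgue_measure R))%E.
Implicit Types (z xi : R * R) (alpha e : R).

(** [|z - conj xi|], the distance of [z] to the reflection of [xi] in the real
    axis. *)
Definition reflected_dist z xi : R :=
  Num.sqrt ((z.1 - xi.1) ^+ 2 + (z.2 + xi.2) ^+ 2).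

(** The modulus of the Bergman kernel, up to its constant. *)
Definition abs_kernel alpha z xi : R := reflected_dist z xi `^ (- (2 + alpha)).

Lemma reflected_dist_ge_re z xi : `|z.1 - xi.1| <= reflected_dist z xi.
Proof.
by rewrite -sqrtr_sqr ler_wsqrtr// lerDl sqr_ge0.
Qed.

Lemma reflected_dist_ge_im z xi : halfplane z -> halfplane xi ->
  z.2 + xi.2 <= reflected_dist z xi.
Proof.
move=> z0 xi0; have h : 0 <= z.2 + xi.2 by rewrite addr_ge0// ltW.
by rewrite -{1}(ger0_norm h) -sqrtr_sqr ler_wsqrtr// lerDr sqr_ge0.
Qed.

Lemma reflected_dist_gt0 z xi : halfplane z -> halfplane xi ->
  0 < reflected_dist z xi.
Proof.
move=> z0 xi0; apply: lt_le_trans (reflected_dist_ge_im z0 xi0).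
by rewrite addr_gt0.
Qed.

Lemma abs_kernel_ge0 alpha z xi : 0 <= abs_kernel alpha z xi.
Proof. exact: powR_ge0. Qed.

Lemma measurable_reflected_dist (D : set ((R * R) * (R * R))) :
  measurable_fun D (fun u => reflected_dist u.1 u.2).
Proof.
apply: (measurable_funS measurableT) => //.
have ms : measurable_fun setT (@Num.sqrt R).
  by apply: continuous_measurable_fun; exact: sqrt_continuous.
apply: (measurableT_comp ms).
have m11 : measurable_fun setT (fun u : (R * R) * (R * R) => u.1.1).
  exact: (measurableT_comp measurable_fst measurable_fst).
have m12 : measurable_fun setT (fun u : (R * R) * (R * R) => u.1.2).
  exact: (measurableT_comp measurable_snd measurable_fst).
have m21 : measurable_fun setT (fun u : (R * R) * (R * R) => u.2.1).
  exact: (measurableT_comp measurable_fst measurable_snd).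
have m22 : measurable_fun setT (fun u : (R * R) * (R * R) => u.2.2).
  exact: (measurableT_comp measurable_snd measurable_snd).
apply: measurable_funD; apply: measurable_funX.
  exact: measurable_funB.
exact: measurable_funD.
Qed.

Lemma measurable_abs_kernel alpha (D : set ((R * R) * (R * R))) :
  measurable_fun D (fun u => abs_kernel alpha u.1 u.2).
Proof.
apply: (measurableT_comp (measurable_powR (- (2 + alpha)))).
exact: measurable_reflected_dist.
Qed.

Lemma measurable_truncated_region N : measurable (@truncated_region R N).
Proof. by apply: measurableX; exact: measurable_itv. Qed.

Lemma truncated_region_halfplane N : @truncated_region R N `<=` halfplane.
Proof.
move=> z [_] /=; rewrite in_itv/= => /andP[h _].
by apply: lt_le_trans h; rewrite invr_gt0.
Qed.

Lemma truncated_region_root N (a : R) :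
  a = - (2 * N.+1%:R) \/ a = - N.+1%:R ->
  truncated_region N `<=` dyadic_box a (3 * N.+1%:R) 0 0.
Proof.
move=> ha [x y]; rewrite /truncated_region /dyadic_box /dyadic_interval /=.
rewrite !in_itv/= expr0 => -[/andP[x1 x2] /andP[y1 y2]].
have M1 : (1 : R) <= N.+1%:R by rewrite ler1n.
have iM : (0 : R) < N.+1%:R^-1 by rewrite invr_gt0.
move: (N.+1%:R : R) (N.+1%:R^-1 : R) ha x1 x2 y1 y2 M1 iM.
by move=> M I [] -> *; split; apply/andP; split; lra.
Qed.

Lemma truncated_region_ndseq : nondecreasing_seq (@truncated_region R).
Proof.
apply/nondecreasing_seqP => n; apply/subsetPset => -[x y].
rewrite /truncated_region /= !in_itv/= => -[/andP[x1 x2] /andP[y1 y2]].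
have h : n.+1%:R <= n.+2%:R :> R by rewrite ler_nat.
have h' : n.+2%:R^-1 <= n.+1%:R^-1 :> R by rewrite lef_pV2// posrE.
move: (n.+1%:R : R) (n.+2%:R : R) (n.+1%:R^-1 : R) (n.+2%:R^-1 : R) x1 x2 y1 y2 h h'.
by move=> *; split; apply/andP; split; lra.
Qed.

Lemma truncated_region_near z : halfplane z ->
  exists N0, forall N, (N0 <= N)%N -> truncated_region N z.
Proof.
move=> z0.
suff [N0 h] : exists N0, truncated_region N0 z.
  exists N0 => N NN; move: h; apply/subsetPset.
  exact: truncated_region_ndseq.
pose m : R := 2 * `|z.1| + z.2 + z.2^-1.
have m0 : 0 <= m by rewrite !addr_ge0 ?invr_ge0 ?mulr_ge0// ltW.
have /andP[_ h] := truncn_itv m0.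
exists (Num.truncn m); rewrite /truncated_region /=.
set M : R := (Num.truncn m).+1%:R in h *.
have z20 : 0 < z.2 := z0.
have zi : 0 < z.2^-1 by rewrite invr_gt0.
have M0 : 0 < M by apply: le_lt_trans h.
have z1 : 0 <= `|z.1| by [].
have : `|z.1| <= M / 2 by move: h; rewrite /m; lra.
rewrite ler_norml !in_itv/= => /andP[h1 h2]; split; apply/andP; split => //.
  by rewrite invf_ple ?posrE//; move: h; rewrite /m; lra.
by move: h; rewrite /m; lra.
Qed.

Lemma bigcup_truncated_region : \bigcup_N @truncated_region R N = halfplane.
Proof.
apply/seteqP; split=> [z [N _]|z /truncated_region_near[N0 h]].
  exact: truncated_region_halfplane.
by exists N0 => //; exact: h.
Qed.

Definition kernel_const alpha : R := 6 `^ (2 + alpha) / (1 + alpha).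

(** [D] plays the role of [|z - conj xi|]; the mass of a box of side [l] is
    [l ^ (2 + alpha) / (1 + alpha)]. *)
Lemma kernel_box alpha (D L : R) k : -1 < alpha -> 0 < L ->
  L / 2 ^+ k <= 6 * D ->
  D `^ (- (2 + alpha)) <= kernel_const alpha * (box_mass alpha L k)^-1.
Proof.
move=> al L0 lD; have l0 := side_gt0 k L0.
set l := L / 2 ^+ k in l0 lD *.
have D0 : 0 < D by lra.
rewrite /box_mass -/l /kernel_const invfM invrK.
rewrite mulrCA !mulrA [_ / (1 + alpha)]mulrC !mulrA.
have -> : l `^ (2 + alpha) = (6 * (l / 6)) `^ (2 + alpha).
  by congr (_ `^ _); field.
have l6 : 0 < l / 6 by rewrite divr_gt0.
rewrite powRM ?(ltW l6)//.
have -> : (1 + alpha)^-1 * ((6 `^ (2 + alpha) * (l / 6) `^ (2 + alpha))^-1)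
   * 6 `^ (2 + alpha) * (1 + alpha) = ((l / 6) `^ (2 + alpha))^-1.
  by field; rewrite ?gt_eqF ?powR_gt0//; lra.
rewrite powRN lef_pV2 ?posrE ?powR_gt0//.
apply: ge0_ler_powR; rewrite ?nnegrE ?(ltW l6) ?(ltW D0)//; lra.
Qed.

Definition tree_kernel alpha (a : R) N z xi : R :=
  tree_operator (dyadic_box a (3 * N.+1%:R))
    (fun k i => \1_(dyadic_box a (3 * N.+1%:R) k i) z / box_mass alpha (3 * N.+1%:R) k)
    (tree_depth N) 0 0 xi.

Lemma tree_kernel_ge0 alpha a N z xi : -1 < alpha -> 0 <= tree_kernel alpha a N z xi.
Proof.
move=> al; apply: tree_operator_ge0 => k i.
by rewrite divr_ge0 ?indicE// ltW// box_mass_gt0// side_gt0// mulr_gt0.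
Qed.

(** Only the term of the common box found by [common_dyadic_box] is kept; the
    other terms of the two sums are nonnegative. *)
Lemma abs_kernel_le_trees alpha N z xi : -1 < alpha ->
  truncated_region N z -> truncated_region N xi ->
  abs_kernel alpha z xi <= kernel_const alpha *
    (tree_kernel alpha (- (2 * N.+1%:R)) N z xi
     + tree_kernel alpha (- N.+1%:R) N z xi).
Proof.
move=> al hz hxi.
have z0 := truncated_region_halfplane hz.
have xi0 := truncated_region_halfplane hxi.
have him := reflected_dist_ge_im z0 xi0.
have zD : z.2 <= reflected_dist z xi by apply: le_trans him; rewrite lerDl ltW.
have xiD : xi.2 <= reflected_dist z xi by apply: le_trans him; rewrite lerDr ltW.
have L0 : 0 < 3 * N.+1%:R :> R by rewrite mulr_gt0.
have [a [k [i [ha kn ik [bz bxi] lD]]]] :=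
  common_dyadic_box hz hxi (reflected_dist_ge_re z xi) zD xiD.
apply: le_trans (kernel_box al L0 lD) _.
have C0 : 0 <= kernel_const alpha.
  by rewrite /kernel_const divr_ge0 ?powR_ge0//; lra.
rewrite ler_wpM2l//.
have H : (box_mass alpha (3 * N.+1%:R) k)^-1 <= tree_kernel alpha a N z xi.
  have := @tree_sum_ge_node R (fun k i => \1_(dyadic_box a (3 * N.+1%:R) k i) xi *
    (\1_(dyadic_box a (3 * N.+1%:R) k i) z / box_mass alpha (3 * N.+1%:R) k))
    (tree_depth N) k i _ kn ik.
  rewrite !indicE !mem_set// mul1r mul1r; apply => k' i'.
  rewrite mulr_ge0 ?indicE// divr_ge0// ltW// box_mass_gt0// side_gt0//.
apply: le_trans H _.
by case: ha => ->; rewrite ?lerDl ?lerDr tree_kernel_ge0.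
Qed.

(** Moving [z0] sideways or up by at most half of its height at most doubles
    [|z0 - conj xi|], uniformly in [xi]. *)
Lemma abs_kernel_comparison alpha z0 z xi : -1 < alpha ->
  halfplane z0 -> halfplane z -> halfplane xi ->
  `|z.1 - z0.1| <= z0.2 / 2 -> z.2 <= z0.2 + z0.2 / 2 ->
  abs_kernel alpha z0 xi <= 2 `^ (2 + alpha) * abs_kernel alpha z xi.
Proof.
move=> al h0 hz hxi d1 d2.
have D0 := reflected_dist_gt0 h0 hxi.
have D1 := reflected_dist_gt0 hz hxi.
have le2 : reflected_dist z xi <= 2 * reflected_dist z0 xi.
  have -> : 2 = Num.sqrt (2 ^+ 2) :> R by rewrite sqrtr_sqr ger0_norm.
  rewrite -sqrtrM ?sqr_ge0// ler_wsqrtr//.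
  move: h0 hz hxi d1 d2; rewrite /halfplane /=.
  case: z0 z xi {D0 D1} => [x0 y0] [x y] [x' y'] /= h0 hz hxi.
  rewrite ler_norml => /andP[d1 d1'] d2.
  (* with these letters the claim is
     [(A + e)^2 + c^2 <= 4 (A^2 + b^2)], where [|e| <= b/2], [c <= 3b/2] *)
  pose A := x0 - x'; pose b := y0 + y'; pose e := x - x0; pose c := y + y'.
  have -> : x - x' = A + e by rewrite /A /e; ring.
  rewrite -/A -/b -/c.
  have e2 : e ^+ 2 <= (b / 2) ^+ 2.
    rewrite -(real_normK (num_real e)) ler_sqr ?nnegrE//; last by rewrite /b; lra.
    by rewrite ler_norml /e /b; apply/andP; split; lra.
  have c2 : c ^+ 2 <= (3 / 2 * b) ^+ 2.
    by rewrite ler_sqr ?nnegrE /c /b; lra.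
  have h := sqr_ge0 (A - e); have b0 := sqr_ge0 b; have A0 := sqr_ge0 A.
  have -> : (A + e) ^+ 2 = 2 * A ^+ 2 + 2 * e ^+ 2 - (A - e) ^+ 2 by ring.
  have eb : (b / 2) ^+ 2 = b ^+ 2 / 4 by field.
  have cb : (3 / 2 * b) ^+ 2 = 9 / 4 * b ^+ 2 by field.
  rewrite eb in e2; rewrite cb in c2.
  move: (e ^+ 2) (c ^+ 2) (b ^+ 2) (A ^+ 2) ((A - e) ^+ 2) e2 c2 h b0 A0.
  by move=> *; lra.
rewrite /abs_kernel !powRN.
have -> : 2 `^ (2 + alpha) / reflected_dist z xi `^ (2 + alpha) =
   ((reflected_dist z xi / 2) `^ (2 + alpha))^-1.
  rewrite powRM ?(ltW D1)// invfM mulrC; congr (_ * _).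
  by rewrite -powR_inv1// -powRrM mulN1r powRN invrK.
have D2 : 0 < reflected_dist z xi / 2 by rewrite divr_gt0.
rewrite lef_pV2 ?posrE ?powR_gt0//.
apply: ge0_ler_powR; rewrite ?nnegrE ?(ltW D0) ?(ltW D2)//; lra.
Qed.

End kernel.

(** * Integration with respect to area *)

Section area_parametric.
Context {R : realType}.
Notation area := ((@lebesgue_measure R) \x (@lebesgue_measure R))%E.

(** The product of two sigma-finite measures is sigma-finite; the squares
    [[-n, n]^2] are explicit witnesses. *)
Lemma sigma_finite_area : sigma_finite setT area.
Proof.
pose I (n : nat) : set R := `[- n%:R, n%:R]%classic.
have UI x : exists n, forall m, (n <= m)%N -> I m x.
  have /andP[_ h] := truncn_itv (normr_ge0 x).
  exists (Num.truncn `|x|).+1 => m nm; rewrite /I /= in_itv/= -ler_norml.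
  by apply: le_trans (ltW h) _; rewrite ler_nat.
exists (fun n => I n `*` I n).
  apply/esym/seteqP; split=> // -[x y] _.
  have [n hn] := UI x; have [m hm] := UI y.
  exists (maxn n m) => //; split => /=.
    by apply: hn; rewrite leq_maxl.
  by apply: hm; rewrite leq_maxr.
move=> n; split; first by apply: measurableX; exact: measurable_itv.
rewrite product_measure1E; [|exact: measurable_itv|exact: measurable_itv].
have h : (lebesgue_measure (I n) < +oo)%E.
  by rewrite /I lebesgue_measure_itv; case: ifP => _; rewrite ?ltry// -EFinB ltry.
by rewrite lte_mul_pinfty// ge0_fin_numE.
Qed.

(** Area bundled as a sigma-finite measure, the form that the Tonelli theorem
    expects for the inner integral. *)
Definition area_measure : {sigma_finite_measure set _ -> \bar R} :=
  HB.pack_for {sigma_finite_measure set _ -> \bar R} area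
    (Measure_isSigmaFinite.Build _ _ _ area sigma_finite_area).

Lemma measurable_area_integral (E D : set (R * R)) (G : R * R -> R * R -> R) :
  measurable E -> measurable D ->
  measurable_fun (E `*` D) (fun u => G u.1 u.2) ->
  (forall z xi, E z -> D xi -> 0 <= G z xi) ->
  measurable_fun E (fun z => \int[area]_(xi in D) (G z xi)%:E)%E.
Proof.
move=> mE mD mG G0.
have mGE : measurable_fun (E `*` D) (fun u => (G u.1 u.2)%:E) by exact/measurable_EFinP.
have GE0 z xi : E z -> D xi -> (0 <= (G z xi)%:E)%E by move=> Ez Dx; rewrite lee_fin G0.
have H := @measurable_parametric_integral _ _ _ _ R area_measure E D (fun z xi => (G z xi)%:E).
exact: (H mE mD mGE GE0).
Qed.

Implicit Types (A D E : set (R * R)) (g : R * R -> R) (c : R).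

(* General facts about integrals, for real integrands and area; fixing the
   measure spares unification the search through the product. *)
Lemma integrableS_area E D (g : R * R -> \bar R) :
  measurable E -> measurable D -> D `<=` E ->
  area.-integrable E g -> area.-integrable D g.
Proof. by move=> mE mD DE; apply: integrableS. Qed.

Lemma le_Rintegral_area A D g : measurable A -> measurable D -> A `<=` D ->
  (forall z, D z -> 0 <= g z) -> area.-integrable D (EFin \o g) ->
  \int[area]_(z in A) g z <= \int[area]_(z in D) g z.
Proof. by move=> mA mD AD g0 gi; apply: le_Rintegral_subset. Qed.

Lemma ge0_subset_integral_area A D g : measurable A -> measurable D -> A `<=` D ->
  measurable_fun D g -> (forall z, D z -> 0 <= g z) ->
  (\int[area]_(z in A) (g z)%:E <= \int[area]_(z in D) (g z)%:E)%E.
Proof.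
move=> mA mD AD mg g0; apply: ge0_subset_integral => //.
exact/measurable_EFinP.
Qed.

Lemma ge0_le_integral_area D g1 g2 : measurable D ->
  measurable_fun D g1 -> measurable_fun D g2 ->
  (forall z, D z -> 0 <= g1 z <= g2 z) ->
  (\int[area]_(z in D) (g1 z)%:E <= \int[area]_(z in D) (g2 z)%:E)%E.
Proof.
move=> mD m1 m2 g12; apply: ge0_le_integral => //.
- by move=> z /g12/andP[]; rewrite lee_fin.
- exact/measurable_EFinP.
- exact/measurable_EFinP.
- by move=> z /g12/andP[]; rewrite lee_fin.
Qed.

Lemma ge0_integralZl_area D c g : measurable D -> measurable_fun D g ->
  (forall z, D z -> 0 <= g z) -> 0 <= c ->
  (\int[area]_(z in D) (c * g z)%:E = c%:E * \int[area]_(z in D) (g z)%:E)%E.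
Proof.
move=> mD mg g0 c0; under eq_integral do rewrite EFinM.
apply: ge0_integralZl => //; exact/measurable_EFinP.
Qed.

Lemma integral_lincomb_area D c g1 g2 : measurable D ->
  area.-integrable D (EFin \o g1) -> area.-integrable D (EFin \o g2) ->
  (\int[area]_(z in D) (c * (g1 z + g2 z))%:E =
   (c * (\int[area]_(z in D) g1 z + \int[area]_(z in D) g2 z))%:E)%E.
Proof.
move=> mD i1 i2.
have i12 := @integrableD _ _ _ area _ mD _ _ i1 i2.
have i := @integrableZl _ _ _ area _ mD c _ i12.
by rewrite integral_EFin_Rintegral// RintegralZl// RintegralD.
Qed.

Lemma le_integrable_area D g1 g2 : measurable D -> measurable_fun D g1 ->
  (forall z, D z -> `|g1 z| <= g2 z) -> area.-integrable D (EFin \o g2) ->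
  area.-integrable D (EFin \o g1).
Proof.
move=> mD m1 g12 i2; apply: le_integrable i2 => //; first exact/measurable_EFinP.
by move=> z Dz; rewrite /= lee_fin (le_trans (g12 _ Dz))// ler_norm.
Qed.

Lemma norm_Rintegral_le_area D g1 g2 : measurable D -> measurable_fun D g1 ->
  (forall z, D z -> `|g1 z| <= g2 z) -> area.-integrable D (EFin \o g2) ->
  `|\int[area]_(z in D) g1 z| <= \int[area]_(z in D) g2 z.
Proof.
move=> mD m1 g12 i2; have i1 := le_integrable_area mD m1 g12 i2.
apply: le_trans (le_normr_Rintegral _ i1) _ => //.
by apply: le_Rintegral => //; exact: (integrable_norm i1).
Qed.

End area_parametric.

(** * Norm bound for the positive operator *)

Section truncated_operator.
Context {R : realType}.
Notation area := ((@lebesgue_measure R) \x (@lebesgue_measure R))%E.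
Variables (p alpha : R) (w f : R * R -> R).
Hypothesis p1 : 1 < p.
Hypothesis al : -1 < alpha.
Hypothesis bw : bekolle_weight p alpha w.
Hypothesis mf : measurable_fun halfplane f.
Hypothesis f0 : forall z, halfplane z -> 0 <= f z.
Hypothesis fi : area.-integrable halfplane
  (EFin \o (fun z => f z `^ p * w z * z.2 `^ alpha)).

Let B := fine (bekolle_cst p alpha w).
Let Psi := \int[area]_(z in halfplane) (f z `^ p * w z * z.2 `^ alpha).
Let h xi := f xi * xi.2 `^ alpha.
Let w0 := weight_gt0 bw.

Let p0 : 0 < p. Proof. exact: lt_trans p1. Qed.

Let al1 : 0 < 1 + alpha. Proof. by rewrite addrC -ltrBlDr sub0r. Qed.

Let h_ge0 xi : halfplane xi -> 0 <= h xi.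
Proof. by move=> Hx; rewrite mulr_ge0 ?f0 ?powR_ge0. Qed.

Definition truncated_op N (z : R * R) : \bar R :=
  (\int[area]_(xi in truncated_region N) (abs_kernel alpha z xi * h xi)%:E)%E.

Definition abs_op (z : R * R) : \bar R :=
  (\int[area]_(xi in halfplane) (abs_kernel alpha z xi * h xi)%:E)%E.

Lemma measurable_kernel_input (E D : set (R * R)) : measurable D -> D `<=` halfplane ->
  measurable_fun (E `*` D) (fun u => abs_kernel alpha u.1 u.2 * h u.2).
Proof.
move=> mD DH; apply: measurable_funM.
  exact: measurable_abs_kernel.
have mh : measurable_fun D h.
  apply: measurable_funM; last exact: measurable_density.
  exact: (measurable_funS measurable_halfplane).
have ms : measurable_fun (E `*` D) (@snd (R * R) (R * R)).
  by apply: (measurable_funS measurableT) => //; exact: measurable_snd.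
apply: (@measurable_comp _ _ _ _ _ _ D) mh ms => //.
by move=> _ [[u v] [_ /= Dv] <-].
Qed.

Lemma measurable_truncated_op N : measurable_fun halfplane (truncated_op N).
Proof.
have mH := @measurable_halfplane R.
have mr := @measurable_truncated_region R N.
have rH := @truncated_region_halfplane R N.
have H := @measurable_area_integral R halfplane (truncated_region N)
  (fun z xi => abs_kernel alpha z xi * h xi) mH mr
  (@measurable_kernel_input halfplane _ mr rH).
apply: H; by move=> z xi _ /rH Hx; rewrite mulr_ge0 ?abs_kernel_ge0// h_ge0.
Qed.

Lemma measurable_abs_op : measurable_fun halfplane abs_op.
Proof.
have mH := @measurable_halfplane R.
have H := @measurable_area_integral R halfplane halfplane
  (fun z xi => abs_kernel alpha z xi * h xi) mH mH
  (@measurable_kernel_input halfplane _ mH (@subset_refl _ _)).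
apply: H; by move=> z xi _ Hx; rewrite mulr_ge0 ?abs_kernel_ge0// h_ge0.
Qed.

Lemma measurable_kernel_section (D : set (R * R)) z : measurable D ->
  D `<=` halfplane ->
  measurable_fun D (fun xi => (abs_kernel alpha z xi * h xi)%:E).
Proof.
move=> mD DH; apply/measurable_EFinP; have mk := @measurable_kernel_input [set: R * R] D mD DH.
have mp : measurable_fun D (fun xi : R * R => (z, xi)).
  by apply: (measurable_funS measurableT) => //; exact: measurable_pair1.
apply: (@measurable_comp _ _ _ _ _ _ ([set: R * R] `*` D) _ D) mk mp.
  exact: measurableX.
by move=> _ [xi Dx <-].
Qed.

Lemma truncated_op_ge0 N z : (0 <= truncated_op N z)%E.
Proof.
apply: integral_ge0 => xi /truncated_region_halfplane Hx.
by rewrite lee_fin mulr_ge0 ?abs_kernel_ge0// h_ge0.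
Qed.

Let ih a L k i := @integrable_dyadic_input R p alpha w f p1 al bw mf f0 fi a L k i.

(** Seen as a dyadic operator in [xi] with coefficients [1_Q (z) / M_Q], the
    kernel integrates to [\sum_Q 1_Q (z) F_Q / M_Q]. *)
Lemma integral_tree_kernel a N z :
  let L := 3 * N.+1%:R in
  area.-integrable (dyadic_box a L 0 0)
    (EFin \o (fun xi => tree_kernel alpha a N z xi * h xi)) /\
  \int[area]_(xi in dyadic_box a L 0 0) (tree_kernel alpha a N z xi * h xi) =
  dyadic_operator alpha f a L (tree_depth N) z.
Proof.
move=> L; have L0 : 0 < L by rewrite /L mulr_gt0.
have a0 k i : 0 <= \1_(dyadic_box a L k i) z / box_mass alpha L k.
  by rewrite divr_ge0 ?indicE// ltW// box_mass_gt0// side_gt0.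
have [H1 H2] := @Rintegral_tree_operator _ _ R area (dyadic_box a L) (dyadic_top a L)
  (@measurable_dyadic_box R a L) (fun k i => dyadic_box_split a k i L0)
  (fun k i => \1_(dyadic_box a L k i) z / box_mass alpha L k) h
  (dyadic_box a L 0 0) (tree_depth N) 0 0 (@measurable_dyadic_box R a L 0 0)
  (ih a 0 0 L0) (@subset_refl _ _) a0.
split; first exact: H1.
rewrite [LHS]H2 /dyadic_operator /sparse_operator /tree_operator.
congr (tree_sum _ _ _ _); apply/funext => k; apply/funext => i.
by rewrite mulrAC mulrA.
Qed.

Lemma kernel_const_ge0 : 0 <= kernel_const alpha :> R.
Proof. by rewrite /kernel_const divr_ge0 ?powR_ge0 ?ltW. Qed.

Lemma dyadic_operator_ge0 a L n z : 0 < L -> 0 <= dyadic_operator alpha f a L n z.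
Proof.
move=> L0; apply: tree_operator_ge0 => k i; rewrite divr_ge0//.
  by apply: Rintegral_ge0 => xi /dyadic_box_halfplane Hx; exact: h_ge0.
by rewrite ltW// box_mass_gt0// side_gt0.
Qed.

Local Opaque dyadic_operator tree_kernel.

Let a0 N : R := - (2 * N.+1%:R).
Let a1 N : R := - N.+1%:R.
Let L N : R := 3 * N.+1%:R.
Let L0 N : 0 < L N. Proof. by rewrite /L mulr_gt0. Qed.

Let root0 N : truncated_region N `<=` dyadic_box (a0 N) (L N) 0 0.
Proof. by apply: truncated_region_root; left. Qed.
Let root1 N : truncated_region N `<=` dyadic_box (a1 N) (L N) 0 0.
Proof. by apply: truncated_region_root; right. Qed.

(** [abs_kernel_le_trees] integrated in [xi]. *)
Lemma truncated_op_le N z : truncated_region N z ->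
  (truncated_op N z <= (kernel_const alpha *
    (dyadic_operator alpha f (a0 N) (L N) (tree_depth N) z
     + dyadic_operator alpha f (a1 N) (L N) (tree_depth N) z))%:E)%E.
Proof.
move=> hz.
have mr := @measurable_truncated_region R N.
have rH := @truncated_region_halfplane R N.
have [i0 e0] := integral_tree_kernel (a0 N) N z.
have [i1 e1] := integral_tree_kernel (a1 N) N z.
have j0 := integrableS_area (@measurable_dyadic_box R _ _ _ _) mr (@root0 N) i0.
have j1 := integrableS_area (@measurable_dyadic_box R _ _ _ _) mr (@root1 N) i1.
have j := @integrableD _ _ _ area _ mr _ _ j0 j1.
have jj := @integrableZl _ _ _ area _ mr (kernel_const alpha) _ j.
apply: (@le_trans _ _ (\int[area]_(xi in truncated_region N)
   (kernel_const alpha * (tree_kernel alpha (a0 N) N z xi * h xi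
     + tree_kernel alpha (a1 N) N z xi * h xi))%:E)%E).
  apply: ge0_le_integral => //.
  - by move=> xi /rH Hx; rewrite lee_fin mulr_ge0 ?abs_kernel_ge0// h_ge0.
  - exact: measurable_kernel_section.
  - exact: measurable_int jj.
  - move=> xi hx; rewrite lee_fin -mulrDl mulrA ler_wpM2r ?h_ge0//; first exact: rH.
    exact: abs_kernel_le_trees.
rewrite (integral_lincomb_area _ mr j0 j1) lee_fin ler_wpM2l ?kernel_const_ge0//.
apply: lerD.
- rewrite -e0; apply: le_Rintegral_subset => //; first exact: measurable_dyadic_box.
  by move=> xi /dyadic_box_halfplane Hx; rewrite mulr_ge0 ?h_ge0// tree_kernel_ge0.
- rewrite -e1; apply: le_Rintegral_subset => //; first exact: measurable_dyadic_box.
  by move=> xi /dyadic_box_halfplane Hx; rewrite mulr_ge0 ?h_ge0// tree_kernel_ge0.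
Qed.

Lemma powR_add_le (x y e : R) : 0 <= e -> 0 <= x -> 0 <= y ->
  (x + y) `^ e <= 2 `^ e * (x `^ e + y `^ e).
Proof.
move=> e0 x0 y0.
wlog xy : x y x0 y0 / x <= y.
  move=> H; have [xy|/ltW yx] := leP x y; first exact: H.
  by rewrite addrC [x `^ _ + _]addrC; exact: H.
apply: (@le_trans _ _ ((2 * y) `^ e)).
  by apply: ge0_ler_powR; rewrite ?nnegrE ?addr_ge0 ?mulr_ge0// mulr_natl mulr2n lerD2r.
by rewrite powRM// ler_wpM2l ?powR_ge0// lerDr powR_ge0.
Qed.

Definition operator_const : R :=
  kernel_const alpha `^ p * 2 `^ p * (2 * weighted_const p alpha).

Lemma operator_const_ge0 : 0 <= operator_const.
Proof.
have wc0 := weighted_const_ge0 alpha p1.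
apply: mulr_ge0; first exact: mulr_ge0 (powR_ge0 _ _) (powR_ge0 _ _).
exact: mulr_ge0 (ler0n _ _) wc0.
Qed.

Let bound : R := operator_const * (B `^ Num.max 1 (p - 1)^-1) `^ p * Psi.

Let tr N z : R := fine (truncated_op N z).

Lemma measurable_trunc_power N (D : set (R * R)) : measurable D -> D `<=` halfplane ->
  measurable_fun D (fun z => tr N z `^ p * (w z * z.2 `^ alpha)).
Proof.
move=> mD DH; apply: measurable_funM.
  apply: measurable_fun_powR_comp.
  apply: (measurable_funS measurable_halfplane DH).
  exact: (measurableT_comp (fine_measurable measurableT) (measurable_truncated_op N)).
apply: measurable_funM; last exact: measurable_density.
exact: (measurable_funS measurable_halfplane DH (measurable_weight bw)).
Qed.

Lemma truncated_op_fin N z : truncated_region N z -> truncated_op N z \is a fin_num.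
Proof.
move=> hz; rewrite ge0_fin_numE ?truncated_op_ge0//.
by apply: le_lt_trans (truncated_op_le hz) _; rewrite ltry.
Qed.

(** Uniform in [N], because [dyadic_operator_bound] is uniform in the root and
    in the depth of the tree. *)
Lemma truncated_op_bound N :
  (\int[area]_(z in truncated_region N) (tr N z `^ p * (w z * z.2 `^ alpha))%:E
   <= bound%:E)%E.
Proof.
have mr := @measurable_truncated_region R N.
have rH := @truncated_region_halfplane R N.
pose s a z := dyadic_operator alpha f a (L N) (tree_depth N) z.
have s0 a z : 0 <= s a z by exact: dyadic_operator_ge0.
have [i0 e0] := dyadic_operator_bound p1 al bw mf f0 fi (a0 N) (tree_depth N) (L0 N).
have [i1 e1] := dyadic_operator_bound p1 al bw mf f0 fi (a1 N) (tree_depth N) (L0 N).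
have j0 := integrableS_area (@measurable_dyadic_box R _ _ _ _) mr (@root0 N) i0.
have j1 := integrableS_area (@measurable_dyadic_box R _ _ _ _) mr (@root1 N) i1.
have j := @integrableD _ _ _ area _ mr _ _ j0 j1.
pose C1 := kernel_const alpha `^ p * 2 `^ p.
have jj := @integrableZl _ _ _ area _ mr C1 _ j.
have u0 z : halfplane z -> 0 <= w z * z.2 `^ alpha.
  by move=> Hz; rewrite mulr_ge0 ?powR_ge0// ltW// w0.
apply: (@le_trans _ _ (\int[area]_(z in truncated_region N)
   (C1 * (s (a0 N) z `^ p * (w z * z.2 `^ alpha)
     + s (a1 N) z `^ p * (w z * z.2 `^ alpha)))%:E)%E).
  apply: ge0_le_integral; first exact: mr.
  - by move=> z /rH Hz; rewrite lee_fin mulr_ge0 ?powR_ge0 ?u0.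
  - by apply/measurable_EFinP; exact: measurable_trunc_power.
  - exact: measurable_int jj.
  - move=> z hz; have Hz := rH _ hz.
    rewrite lee_fin -mulrDl [C1 * _]mulrA ler_wpM2r ?u0//.
    rewrite /C1 -mulrA.
    apply: le_trans (ler_wpM2l (powR_ge0 _ _) (powR_add_le (ltW p0) (s0 _ _) (s0 _ _))).
    have ss0 := addr_ge0 (s0 (a0 N) z) (s0 (a1 N) z).
    rewrite -(powRM _ kernel_const_ge0 ss0).
    have tge : 0 <= tr N z by rewrite fine_ge0// truncated_op_ge0.
    apply: ge0_ler_powR; rewrite ?nnegrE ?(ltW p0)//.
      exact: mulr_ge0 kernel_const_ge0 ss0.
    rewrite -lee_fin fineK ?truncated_op_fin//.
    exact: truncated_op_le.
rewrite (integral_lincomb_area C1 mr j0 j1) lee_fin.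
have C10 : 0 <= C1 by rewrite mulr_ge0 ?powR_ge0.
have -> : bound = C1 * (weighted_const p alpha * (B `^ Num.max 1 (p - 1)^-1) `^ p * Psi
   + weighted_const p alpha * (B `^ Num.max 1 (p - 1)^-1) `^ p * Psi).
  by rewrite /bound /operator_const -/C1; ring.
rewrite ler_wpM2l//; apply: lerD.
- apply: (le_trans _ e0).
  apply: (le_Rintegral_area mr (@measurable_dyadic_box R _ _ _ _) (@root0 N) _ i0).
  by move=> xi /dyadic_box_halfplane Hx; rewrite mulr_ge0 ?u0 ?powR_ge0.
- apply: (le_trans _ e1).
  apply: (le_Rintegral_area mr (@measurable_dyadic_box R _ _ _ _) (@root1 N) _ i1).
  by move=> xi /dyadic_box_halfplane Hx; rewrite mulr_ge0 ?u0 ?powR_ge0.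
Qed.

Lemma truncated_op_nd z : halfplane z -> nondecreasing_seq (truncated_op ^~ z).
Proof.
move=> Hz m n mn; apply: ge0_subset_integral => //.
- exact: measurable_truncated_region.
- exact: measurable_truncated_region.
- apply: measurable_kernel_section; first exact: measurable_truncated_region.
  exact: truncated_region_halfplane.
- move=> xi /truncated_region_halfplane Hx.
  by rewrite lee_fin mulr_ge0 ?abs_kernel_ge0// h_ge0.
- by apply/subsetPset; exact: truncated_region_ndseq.
Qed.

Lemma truncated_op_cvg z : halfplane z -> truncated_op N z @[N --> \oo] --> abs_op z.
Proof.
move=> Hz; rewrite /abs_op -(@bigcup_truncated_region R).
apply: ge0_nondecreasing_set_cvg_integral.
- exact: truncated_region_ndseq.
- by move=> N; exact: measurable_truncated_region.
- move=> N; apply: measurable_kernel_section; first exact: measurable_truncated_region.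
  exact: truncated_region_halfplane.
- move=> N xi /truncated_region_halfplane Hx.
  by rewrite lee_fin mulr_ge0 ?abs_kernel_ge0// h_ge0.
Qed.

Lemma truncated_op_comparison N z0 z : halfplane z0 -> halfplane z ->
  `|z.1 - z0.1| <= z0.2 / 2 -> z.2 <= z0.2 + z0.2 / 2 ->
  (truncated_op N z0 <= (2 `^ (2 + alpha))%:E * truncated_op N z)%E.
Proof.
move=> H0 Hz d1 d2.
have mr := @measurable_truncated_region R N.
have rH := @truncated_region_halfplane R N.
have mk z' : measurable_fun (truncated_region N) (fun xi => abs_kernel alpha z' xi * h xi).
  by apply/measurable_EFinP; exact: measurable_kernel_section.
have k0 z' xi : truncated_region N xi -> 0 <= abs_kernel alpha z' xi * h xi.
  by move=> /rH Hx; rewrite mulr_ge0 ?abs_kernel_ge0 ?h_ge0.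
have mc : measurable_fun (truncated_region N)
    (fun xi => 2 `^ (2 + alpha) * (abs_kernel alpha z xi * h xi)).
  by apply: measurable_funM.
rewrite /truncated_op -(ge0_integralZl_area mr (mk z) (k0 z) (powR_ge0 _ _)).
apply: (ge0_le_integral_area mr (mk z0) mc) => xi hx.
rewrite k0//= mulrA ler_wpM2r ?h_ge0//; first exact: rH.
by apply: abs_kernel_comparison => //; exact: rH.
Qed.

Let u z := w z * z.2 `^ alpha.

Let u_gt0 z : halfplane z -> 0 < u z.
Proof. by move=> Hz; rewrite mulr_gt0 ?w0// powR_gt0. Qed.

Let measurable_u (D : set (R * R)) : D `<=` halfplane -> measurable_fun D u.
Proof.
move=> DH; apply: measurable_funM; last exact: measurable_density.
exact: (measurable_funS measurable_halfplane DH (measurable_weight bw)).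
Qed.

Let tr_ge0 N z : 0 <= tr N z. Proof. by rewrite fine_ge0// truncated_op_ge0. Qed.

(* points that [abs_kernel_comparison] compares with [z0] *)
Let square (z0 : R * R) : set (R * R) :=
  `[z0.1, z0.1 + z0.2 / 2]%classic `*` `[z0.2, z0.2 + z0.2 / 2]%classic.

Lemma square_region z0 : halfplane z0 ->
  exists N0, forall N, (N0 <= N)%N -> square z0 `<=` truncated_region N.
Proof.
move=> H0; have y0 : 0 < z0.2 / 2 by rewrite divr_gt0.
have H1 : halfplane (z0.1 + z0.2 / 2, z0.2 + z0.2 / 2) by rewrite /halfplane /= addr_gt0.
have [N0 h0] := truncated_region_near H0.
have [N1 h1] := truncated_region_near H1.
exists (maxn N0 N1) => N; rewrite geq_max => /andP[/h0 + /h1].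
rewrite /truncated_region /square /= !in_itv/=.
move=> [/andP[d1 d2] /andP[d3 d4]] [/andP[b1 b2] /andP[b3 b4]] [x y] /=.
rewrite !in_itv/= => -[/andP[c1 c2] /andP[c3 c4]]; split; apply/andP; split.
- exact: le_trans c1.
- exact: le_trans b2.
- exact: le_trans c3.
- exact: le_trans b4.
Qed.

Lemma abs_op_ge0 z : (0 <= abs_op z)%E.
Proof.
apply: integral_ge0 => xi Hx.
by rewrite lee_fin mulr_ge0 ?abs_kernel_ge0// h_ge0.
Qed.

Lemma truncated_op_le_abs_op N z : halfplane z -> (truncated_op N z <= abs_op z)%E.
Proof.
move=> Hz; apply: ge0_subset_integral.
- exact: measurable_truncated_region.
- exact: measurable_halfplane.
- by apply: measurable_kernel_section; first exact: measurable_halfplane.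
- by move=> xi Hx; rewrite lee_fin mulr_ge0 ?abs_kernel_ge0// h_ge0.
- exact: truncated_region_halfplane.
Qed.

Let fine_le_scale (c : R) (x y : \bar R) : x \is a fin_num -> y \is a fin_num ->
  (x <= c%:E * y)%E -> fine x <= c * fine y.
Proof. by case: x y => [x||] [y||]//= _ _; rewrite -EFinM lee_fin. Qed.

Local Opaque truncated_op abs_op truncated_region.

(** On the square with lower left corner [z0] all values of the truncated
    operator are at least a fixed multiple of its value at [z0].  The weighted
    norm being bounded uniformly in [N] and the square having positive weighted
    mass, the value at [z0] is bounded. *)
Lemma truncated_op_unif_bounded z0 : halfplane z0 ->
  exists K N0, forall N, (N0 <= N)%N -> (truncated_op N z0 <= K%:E)%E.
Proof.
move=> H0; have y0 : 0 < z0.2 / 2 by rewrite divr_gt0.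
have [N0 hN0] := square_region H0.
have mS : measurable (square z0) by apply: measurableX; exact: measurable_itv.
have SH : square z0 `<=` halfplane.
  by apply: subset_trans (hN0 N0 (leqnn _)) _; exact: truncated_region_halfplane.
have aS : (0 < area (square z0))%E.
  rewrite area_rectangle; [|exact: measurable_itv|exact: measurable_itv].
  rewrite !lebesgue_measure_itv/= !lte_fin !ltrDl y0 -!EFinB -EFinM lte_fin.
  by rewrite mulr_gt0// subr_gt0 ltrDl.
have muE : measurable_fun (square z0) (fun z => (u z)%:E).
  by apply/measurable_EFinP; exact: measurable_u.
have W0 : (0 < \int[area]_(z in square z0) (u z)%:E)%E.
  by apply: integral_gt0 => // z /SH Hz; rewrite lte_fin u_gt0.
(* the weighted mass of the square may be infinite; a positive real below it
   suffices *)
have [e e0 eW] : exists2 e, 0 < e & (e%:E <= \int[area]_(z in square z0) (u z)%:E)%E.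
  case: (\int[area]_(z in square z0) (u z)%:E)%E W0 => [r r0|_|//].
    by exists r => //; rewrite -lte_fin.
  by exists 1 => //; exact: leey.
pose c : R := 2 `^ (2 + alpha).
exists ((c `^ p * bound / e) `^ p^-1), N0 => N NN.
have SN := hN0 N NN.
have z0S : square z0 z0.
  by rewrite /square /= !in_itv/= !lexx !lerDl !(ltW y0).
have fin z : square z0 z -> truncated_op N z \is a fin_num.
  by move=> /SN; exact: truncated_op_fin.
rewrite -(fineK (fin _ z0S)) lee_fin -/(tr N z0).
have cmp z : square z0 z -> tr N z0 <= c * tr N z.
  move=> Sz; apply: (fine_le_scale (fin _ z0S) (fin _ Sz)).
  apply: truncated_op_comparison; [exact: H0|exact: SH| |].
  - move: Sz; rewrite /square /= !in_itv/= => -[/andP[c1 c2] _].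
    by rewrite ger0_norm ?subr_ge0// lerBlDl.
  - by move: Sz; rewrite /square /= !in_itv/= => -[_ /andP[]].
have pw0 N' z : square z0 z -> 0 <= tr N' z `^ p * u z.
  by move=> /SH Hz; rewrite mulr_ge0 ?powR_ge0// ltW// u_gt0.
have mt := measurable_trunc_power N mS SH.
have mu_ := measurable_u SH.
have key : ((tr N z0 `^ p)%:E * \int[area]_(z in square z0) (u z)%:E <=
    (c `^ p)%:E * bound%:E)%E.
  rewrite -(ge0_integralZl_area mS mu_ _ (powR_ge0 _ _)); last first.
    by move=> z /SH Hz; rewrite ltW// u_gt0.
  apply: (@le_trans _ _ ((c `^ p)%:E * \int[area]_(z in square z0)
      (tr N z `^ p * u z)%:E)%E).
    rewrite -(ge0_integralZl_area mS mt (pw0 N) (powR_ge0 _ _)).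
    apply: (ge0_le_integral_area mS).
    - exact: measurable_funM.
    - exact: measurable_funM.
    - move=> z Sz; have uz := ltW (u_gt0 (SH _ Sz)).
      rewrite mulr_ge0 ?powR_ge0//= mulrA ler_wpM2r//.
      rewrite -powRM ?powR_ge0//.
      by apply: ge0_ler_powR; rewrite ?nnegrE ?(ltW p0) ?mulr_ge0 ?powR_ge0 ?cmp.
  rewrite lee_wpmul2l ?lee_fin ?powR_ge0//.
  apply: le_trans (truncated_op_bound N).
  apply: ge0_subset_integral_area => //; first exact: measurable_truncated_region.
    apply: measurable_trunc_power; first exact: measurable_truncated_region.
    exact: truncated_region_halfplane.
  move=> z /truncated_region_halfplane Hz.
  by rewrite mulr_ge0 ?powR_ge0// ltW// u_gt0.
have : ((tr N z0 `^ p * e)%:E <= (c `^ p * bound)%:E)%E.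
  by rewrite !EFinM; apply: le_trans key; rewrite lee_wpmul2l ?lee_fin ?powR_ge0.
rewrite lee_fin -ler_pdivlMr// => k.
have -> : tr N z0 = (tr N z0 `^ p) `^ p^-1.
  by rewrite -powRrM divff ?powRr1// gt_eqF.
apply: ge0_ler_powR; rewrite ?nnegrE ?powR_ge0 ?invr_ge0 ?(ltW p0)//.
exact: le_trans (powR_ge0 _ _) k.
Qed.

Lemma abs_op_fin z : halfplane z -> abs_op z \is a fin_num.
Proof.
move=> Hz; have [K [N0 hK]] := truncated_op_unif_bounded Hz.
rewrite ge0_fin_numE ?abs_op_ge0//; apply: (@le_lt_trans _ _ K%:E); last exact: ltry.
have cv := truncated_op_cvg Hz.
rewrite -(cvg_lim _ cv)//; apply: lime_le; first by apply/cvg_ex; exists (abs_op z).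
by exists N0 => // N /=; exact: hK.
Qed.

(** The limit [0] is treated apart: for it all truncations vanish, while
    continuity of [y |-> y ^ p] is available at positive points. *)
Lemma trunc_power_cvg z : halfplane z ->
  tr N z `^ p @[N --> \oo] --> fine (abs_op z) `^ p.
Proof.
move=> Hz; have fz := abs_op_fin Hz.
have cv : tr N z @[N --> \oo] --> fine (abs_op z).
  have := truncated_op_cvg Hz; rewrite -(fineK fz) => c.
  exact: (fine_cvg c).
have : 0 <= fine (abs_op z) by rewrite fine_ge0// abs_op_ge0.
rewrite le_eqVlt => /predU1P[e|pos].
  have t0 N : tr N z = 0.
    apply/eqP; rewrite eq_le tr_ge0 andbT e /tr fine_le//.
      rewrite ge0_fin_numE ?truncated_op_ge0//.
      by apply: le_lt_trans (truncated_op_le_abs_op N Hz) _; rewrite -ge0_fin_numE ?abs_op_ge0.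
    exact: truncated_op_le_abs_op.
  under eq_fun do rewrite t0.
  by rewrite -e; exact: cvg_cst.
have c2 : y `^ p @[y --> fine (abs_op z)] --> fine (abs_op z) `^ p.
  exact: (@continuous_powR R p _ pos).
exact: (cvg_comp _ _ cv c2).
Qed.

(** Monotone convergence: the truncations of the operator, restricted to the
    truncated regions, increase to the operator on the half-plane. *)
Lemma abs_op_bound :
  (\int[area]_(z in halfplane) (fine (abs_op z) `^ p * u z)%:E <= bound%:E)%E.
Proof.
have mH := @measurable_halfplane R.
pose G N z := ((fun z => (tr N z `^ p * u z)%:E) \_ (truncated_region N)) z.
have tfin N z : halfplane z -> truncated_op N z \is a fin_num.
  move=> Hz; rewrite ge0_fin_numE ?truncated_op_ge0//.
  by apply: le_lt_trans (truncated_op_le_abs_op N Hz) _; rewrite -ge0_fin_numE ?abs_op_ge0// abs_op_fin.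
have G_ge0 N z : halfplane z -> (0 <= G N z)%E.
  move=> Hz; apply: erestrict_ge0 => z' /truncated_region_halfplane Hz'.
  by rewrite lee_fin mulr_ge0 ?powR_ge0// ltW// u_gt0.
have mG N : measurable_fun halfplane (G N).
  apply/(measurable_restrict _ (@measurable_truncated_region R N) mH).
  apply/measurable_EFinP; apply: measurable_trunc_power.
    by apply: measurableI => //; exact: measurable_truncated_region.
  exact: subIsetl.
have ndG z : halfplane z -> nondecreasing_seq (G ^~ z).
  move=> Hz m n mn; rewrite /G !patchE.
  have [zm|/negbTE zm] := boolP (z \in truncated_region m); last first.
    have := G_ge0 n _ Hz; rewrite /G patchE; exact.
  have zn : z \in truncated_region n.
    rewrite inE; move: zm; rewrite inE; apply/subsetPset.
    exact: truncated_region_ndseq.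
  rewrite zn lee_fin; apply: ler_wpM2r; first exact: ltW (u_gt0 Hz).
  apply: ge0_ler_powR; rewrite ?nnegrE ?(ltW p0)//.
  by rewrite fine_le ?tfin//; exact: truncated_op_nd.
have cG z : halfplane z -> G N z @[N --> \oo] --> (fine (abs_op z) `^ p * u z)%:E.
  move=> Hz; have [N0 hN] := truncated_region_near Hz.
  have c1 : (tr N z `^ p * u z)%:E @[N --> \oo] --> (fine (abs_op z) `^ p * u z)%:E.
    apply: cvg_EFin; first by near=> n.
    exact: cvgMl (trunc_power_cvg Hz).
  apply: cvg_trans c1; apply: near_eq_cvg; exists N0 => // N /= NN.
  by rewrite /G patchE mem_set//; exact: hN.
have E : (\int[area]_(z in halfplane) (fine (abs_op z) `^ p * u z)%:E =
    \int[area]_(z in halfplane) limn (G ^~ z))%E.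
  apply: eq_integral => z /[!inE] Hz.
  by apply/esym/cvg_lim => //; exact: cG.
rewrite E (monotone_convergence area mH mG G_ge0 ndG).
apply: lime_le.
  apply: ereal_nondecreasing_is_cvgn => m n mn.
  apply: ge0_le_integral; [exact: mH|exact: G_ge0|exact: mG|exact: mG|].
  by move=> z Hz; exact: ndG.
apply: nearW => N; rewrite /G -integral_mkcondr setIidr//; last first.
  exact: truncated_region_halfplane.
exact: truncated_op_bound.
Unshelve. all: by end_near. Qed.

End truncated_operator.

(** * Measurability of the complex kernel *)

Section complex_kernel.
Context {R : realType}.
Notation area := ((@lebesgue_measure R) \x (@lebesgue_measure R))%E.
Import ComplexField.Normc.
Local Open Scope complex_scope.
Notation Re := complex.Re.
Notation Im := complex.Im.
Implicit Types (c d : R[i]) (z xi : R * R).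

Lemma normc_sqrt c : normc c = Num.sqrt (Re c ^+ 2 + Im c ^+ 2).
Proof. by case: c. Qed.

Lemma Re_le_normc c : `|Re c| <= normc c.
Proof. by rewrite normc_sqrt -sqrtr_sqr ler_wsqrtr// lerDl sqr_ge0. Qed.

Lemma Im_le_normc c : `|Im c| <= normc c.
Proof. by rewrite normc_sqrt -sqrtr_sqr ler_wsqrtr// lerDr sqr_ge0. Qed.

Lemma normc_ge0 c : 0 <= normc c.
Proof. by rewrite normc_sqrt sqrtr_ge0. Qed.

Lemma normc_le_ReIm c : normc c <= `|Re c| + `|Im c|.
Proof.
rewrite normc_sqrt -(@ger0_norm _ (`|Re c| + `|Im c|)) ?addr_ge0//.
rewrite -sqrtr_sqr ler_wsqrtr// sqrrD !real_normK ?num_real//.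
by rewrite addrAC lerDl mulrn_wge0// mulr_ge0.
Qed.

Lemma ReM c d : Re (c * d) = Re c * Re d - Im c * Im d.
Proof. by case: c d => [a b] [x y]. Qed.

Lemma ImM c d : Im (c * d) = Re c * Im d + Im c * Re d.
Proof. by case: c d => [a b] [x y]. Qed.

Lemma ReV c : Re c^-1 = Re c / (Re c ^+ 2 + Im c ^+ 2).
Proof. by case: c. Qed.

Lemma ImV c : Im c^-1 = - (Im c / (Re c ^+ 2 + Im c ^+ 2)).
Proof. by case: c. Qed.

Lemma normc_cpowR c (s : R) : normc (cpowR c s) = normc c `^ s.
Proof.
rewrite normc_sqrt /cpowR /= !exprMn -mulrDr cos2Dsin2 mulr1.
by rewrite sqrtr_sqr ger0_norm// powR_ge0.
Qed.

Definition reflected z xi : R[i] := toC z - conjc (toC xi).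

Lemma reflectedE z xi : reflected z xi = (z.1 - xi.1) +i* (z.2 + xi.2).
Proof. by rewrite /reflected /toC /=; simpc. Qed.

Lemma normc_reflected z xi : normc (reflected z xi) = reflected_dist z xi.
Proof. by rewrite reflectedE. Qed.

Lemma normc_bergman_integrand alpha (f : R * R -> R[i]) z xi :
  normc (bergman_integrand alpha f z xi) =
  abs_kernel alpha z xi * normc (f xi).
Proof.
rewrite /bergman_integrand normcM normcV normc_cpowR -/(reflected z xi).
by rewrite normc_reflected /abs_kernel powRN mulrC.
Qed.

Let HH : set ((R * R) * (R * R)) := halfplane `*` halfplane.

Let m1 : measurable_fun HH (fun u : (R * R) * (R * R) => u.1.1).
Proof.
apply: (measurable_funS measurableT) => //.
exact: (measurableT_comp measurable_fst measurable_fst).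
Qed.

Let m3 : measurable_fun HH (fun u : (R * R) * (R * R) => u.2.1).
Proof.
apply: (measurable_funS measurableT) => //.
exact: (measurableT_comp measurable_fst measurable_snd).
Qed.

Let mHH : measurable HH.
Proof. by apply: measurableX; exact: measurable_halfplane. Qed.

Lemma measurable_inv_gt0 (h : (R * R) * (R * R) -> R) :
  (forall u, HH u -> 0 < h u) -> measurable_fun HH h ->
  measurable_fun HH (fun u => (h u)^-1).
Proof.
move=> h0 mh; apply: (eq_measurable_fun (fun u => h u `^ (-1))).
  by move=> u /[!inE] Hu; rewrite powR_inv1// ltW// h0.
exact: (measurableT_comp (measurable_powR (-1)) mh).
Qed.

Let angle (u : (R * R) * (R * R)) : R := (u.1.1 - u.2.1) / reflected_dist u.1 u.2.

Let angle_lt1 u : HH u -> -1 < angle u < 1.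
Proof.
move=> [H1 H2]; have D0 := reflected_dist_gt0 H1 H2.
rewrite /angle -ltr_norml normrM normfV (gtr0_norm D0) ltr_pdivrMr// mul1r.
rewrite -sqrtr_sqr /reflected_dist ltr_sqrt.
  by rewrite ltrDl exprn_gt0// addr_gt0.
by rewrite ltr_wpDl ?sqr_ge0// exprn_gt0// addr_gt0.
Qed.

(** [z - conj xi] has positive imaginary part, so its argument is the branch
    [acos (Re / modulus)], with a quotient strictly between [-1] and [1], where
    [acos] is continuous. *)
Lemma measurable_arg_reflected :
  measurable_fun HH (fun u => Arg (reflected u.1 u.2)).
Proof.
apply: (eq_measurable_fun (fun u => acos (angle u))).
  move=> u /[!inE] -[H1 H2]; rewrite /Arg normc_reflected reflectedE /=.
  by rewrite addr_ge0// ltW.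
have macos : measurable_fun `](-1 : R), 1[%classic (@acos R).
  apply: open_continuous_measurable_fun; first exact: interval_open.
  by move=> x; rewrite inE /= in_itv/= => h; exact: continuous_acos.
have ma : measurable_fun HH angle.
  apply: measurable_funM; first exact: measurable_funB.
  apply: measurable_inv_gt0; last exact: measurable_reflected_dist.
  by move=> u [H1 H2]; exact: reflected_dist_gt0.
apply: (@measurable_comp _ _ _ _ _ _ `](-1 : R), 1[%classic) macos ma.
  exact: measurable_itv.
by move=> _ [u Hu <-]; rewrite /= in_itv/=; exact: angle_lt1.
Qed.

Lemma measurable_inv_kernel (s : R) :
  measurable_fun HH (fun u => Re (cpowR (reflected u.1 u.2) s)^-1) /\
  measurable_fun HH (fun u => Im (cpowR (reflected u.1 u.2) s)^-1).
Proof.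
have mc : measurable_fun setT (@cos R).
  by apply: continuous_measurable_fun; exact: continuous_cos.
have ms : measurable_fun setT (@sin R).
  by apply: continuous_measurable_fun; exact: continuous_sin.
have mr : measurable_fun HH (fun u => normc (reflected u.1 u.2) `^ s).
  under eq_fun do rewrite normc_reflected.
  apply: (measurableT_comp (measurable_powR s)).
  exact: measurable_reflected_dist.
have ma : measurable_fun HH (fun u => s * Arg (reflected u.1 u.2)).
  by apply: measurable_funM => //; exact: measurable_arg_reflected.
have mRe : measurable_fun HH (fun u => Re (cpowR (reflected u.1 u.2) s)).
  by apply: measurable_funM => //; exact: (measurableT_comp mc ma).
have mIm : measurable_fun HH (fun u => Im (cpowR (reflected u.1 u.2) s)).
  by apply: measurable_funM => //; exact: (measurableT_comp ms ma).
have mq : measurable_fun HH (fun u => (Re (cpowR (reflected u.1 u.2) s) ^+ 2 +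
    Im (cpowR (reflected u.1 u.2) s) ^+ 2)^-1).
  apply: measurable_inv_gt0.
    move=> u [H1 H2].
    have h : 0 < normc (cpowR (reflected u.1 u.2) s).
      by rewrite normc_cpowR powR_gt0// normc_reflected reflected_dist_gt0.
    by move: h; rewrite normc_sqrt sqrtr_gt0.
  by apply: measurable_funD; apply: measurable_funX.
split.
  by under eq_fun do rewrite ReV; exact: measurable_funM.
by under eq_fun do rewrite ImV; apply: measurableT_comp => //; exact: measurable_funM.
Qed.

Lemma measurable_bergman_integrand alpha (f : R * R -> R[i]) :
  measurable_fun halfplane (fun z => Re (f z)) ->
  measurable_fun halfplane (fun z => Im (f z)) ->
  measurable_fun HH (fun u => Re (bergman_integrand alpha f u.1 u.2)) /\
  measurable_fun HH (fun u => Im (bergman_integrand alpha f u.1 u.2)).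
Proof.
move=> mRe mIm.
have [k1 k2] := measurable_inv_kernel (2 + alpha).
have msnd : measurable_fun HH (@snd (R * R) (R * R)).
  by apply: (measurable_funS measurableT) => //; exact: measurable_snd.
have sub : [set (u.2 : R * R) | u in HH] `<=` halfplane.
  by move=> _ [u [_ Hu] <-].
have f1 : measurable_fun HH (fun u => Re (f u.2)).
  exact: (@measurable_comp _ _ _ _ _ _ halfplane) measurable_halfplane sub mRe msnd.
have f2 : measurable_fun HH (fun u => Im (f u.2)).
  exact: (@measurable_comp _ _ _ _ _ _ halfplane) measurable_halfplane sub mIm msnd.
split.
  under eq_fun do rewrite /bergman_integrand ReM.
  by apply: measurable_funB; exact: measurable_funM.
under eq_fun do rewrite /bergman_integrand ImM.
by apply: measurable_funD; exact: measurable_funM.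
Qed.

(** The integral of a signed function is by definition the difference of those
    of its positive and negative parts, to which Tonelli applies; no
    integrability is required for measurability. *)
Lemma measurable_signed_area_integral (G : R * R -> R * R -> R) :
  measurable_fun HH (fun u => G u.1 u.2) ->
  measurable_fun halfplane (fun z => \int[area]_(xi in halfplane) (G z xi)%:E)%E.
Proof.
move=> mG; have mH := @measurable_halfplane R.
have m0 : measurable_fun HH (fun=> 0 : R) by exact: measurable_cst.
have mp := @measurable_area_integral R halfplane halfplane
  (fun z xi => Num.max (G z xi) 0) mH mH (measurable_maxr mG m0).
have mn := @measurable_area_integral R halfplane halfplane
  (fun z xi => Num.max (- G z xi) 0) mH mH
  (measurable_maxr (measurableT_comp (@oppr_measurable R setT) mG) m0).
have E z : (\int[area]_(xi in halfplane) (G z xi)%:E =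
    \int[area]_(xi in halfplane) (Num.max (G z xi) 0)%:E
    - \int[area]_(xi in halfplane) (Num.max (- G z xi) 0)%:E)%E.
  rewrite integralE; congr (_ - _)%E; apply: eq_integral => xi _.
    by rewrite funeposE EFin_max.
  by rewrite funenegE EFin_max.
under eq_fun do rewrite E.
apply: emeasurable_funB.
  by apply: mp => z xi _ _; rewrite le_max lexx orbT.
by apply: mn => z xi _ _; rewrite le_max lexx orbT.
Qed.

End complex_kernel.

(** * The Bergman projection *)

Section bergman_projection.
Context {R : realType}.
Notation area := ((@lebesgue_measure R) \x (@lebesgue_measure R))%E.
Import ComplexField.Normc.
Local Open Scope complex_scope.
Notation Re := complex.Re.
Notation Im := complex.Im.
Variables (p alpha : R) (w : R * R -> R) (f : R * R -> R[i]).
Hypothesis p1 : 1 < p.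
Hypothesis al : -1 < alpha.
Hypothesis bw : bekolle_weight p alpha w.
Hypothesis Lf : Lp_space p alpha w f.

Let F z := normc (f z).
Let psi z := F z `^ p * w z * z.2 `^ alpha.

Let p0 : 0 < p. Proof. exact: lt_trans p1. Qed.

Lemma int_dA_halfplane (h : R * R -> R) :
  int_dA alpha halfplane (fun z => (h z)%:E) =
  (\int[area]_(z in halfplane) (h z * z.2 `^ alpha)%:E)%E.
Proof. by rewrite /int_dA setIid; under eq_integral do rewrite -EFinM. Qed.

Lemma measurable_normc (g : R * R -> R[i]) :
  measurable_fun halfplane (fun z => Re (g z)) ->
  measurable_fun halfplane (fun z => Im (g z)) ->
  measurable_fun halfplane (fun z => normc (g z)).
Proof.
move=> mRe mIm; under eq_fun do rewrite normc_sqrt.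
have ms : measurable_fun setT (@Num.sqrt R).
  by apply: continuous_measurable_fun; exact: sqrt_continuous.
apply: (measurableT_comp ms).
by apply: measurable_funD; exact: measurable_funX.
Qed.

Lemma measurable_input_norm : measurable_fun halfplane F.
Proof. by have [mRe mIm _] := Lf; exact: measurable_normc. Qed.

Let F_ge0 z : halfplane z -> 0 <= F z. Proof. by move=> _; exact: normc_ge0. Qed.

Let psi_ge0 z : halfplane z -> 0 <= psi z.
Proof.
move=> Hz; rewrite mulr_ge0 ?powR_ge0// mulr_ge0 ?powR_ge0//.
by rewrite ltW// (weight_gt0 bw).
Qed.

Let measurable_psi : measurable_fun halfplane psi.
Proof.
apply: measurable_funM; last exact: measurable_density.
apply: measurable_funM; last exact: measurable_weight bw.
by apply: measurable_fun_powR_comp; exact: measurable_input_norm.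
Qed.

Lemma Lp_norm_psi :
  Lp_norm p alpha w f = ((\int[area]_(z in halfplane) (psi z)%:E) `^ p^-1)%E.
Proof. by rewrite /Lp_norm (int_dA_halfplane (fun z => normc (f z) `^ p * w z)). Qed.

Lemma integrable_psi : area.-integrable halfplane (EFin \o psi).
Proof.
apply: ge0_integrable => //.
have [_ _] := Lf; rewrite Lp_norm_psi => ffin.
have pV : p^-1 != 0 by rewrite invr_eq0 gt_eqF.
exact: lty_poweRy pV ffin.
Qed.

Let mF := measurable_input_norm.
Let Ffin z : halfplane z -> abs_op alpha F z \is a fin_num.
Proof. by move=> Hz; exact: (abs_op_fin p1 al bw mF F_ge0 integrable_psi). Qed.

Let mHH := measurable_bergman_integrand alpha (let: And3 h _ _ := Lf in h)
  (let: And3 _ h _ := Lf in h).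

Let Gre z xi := Re (bergman_integrand alpha f z xi) * xi.2 `^ alpha.
Let Gim z xi := Im (bergman_integrand alpha f z xi) * xi.2 `^ alpha.

Let measurable_G :
  measurable_fun (halfplane `*` halfplane) (fun u => Gre u.1 u.2) /\
  measurable_fun (halfplane `*` halfplane) (fun u => Gim u.1 u.2).
Proof.
have [m1 m2] := mHH.
have md : measurable_fun (halfplane `*` halfplane)
    (fun u : (R * R) * (R * R) => u.2.2 `^ alpha).
  apply: (measurable_funS measurableT) => //.
  apply: (measurableT_comp (measurable_powR alpha)).
  exact: (measurableT_comp measurable_snd measurable_snd).
by split; apply: measurable_funM.
Qed.

Let section_measurable (G : R * R -> R * R -> R) z : halfplane z ->
  measurable_fun (halfplane `*` halfplane) (fun u => G u.1 u.2) ->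
  measurable_fun halfplane (G z).
Proof.
move=> Hz mG.
have mp : measurable_fun halfplane (fun xi : R * R => (z, xi)).
  by apply: (measurable_funS measurableT) => //; exact: measurable_pair1.
apply: (@measurable_comp _ _ _ _ _ _ (halfplane `*` halfplane)) mG mp.
  by apply: measurableX; exact: measurable_halfplane.
by move=> _ [xi Hx <-].
Qed.

Let dominating z xi := abs_kernel alpha z xi * (F xi * xi.2 `^ alpha).

Let dominating_integrable z : halfplane z ->
  area.-integrable halfplane (EFin \o dominating z).
Proof.
move=> Hz; apply: ge0_integrable.
- apply/measurable_EFinP; apply: (measurable_kernel_section alpha mF) => //.
  exact: measurable_halfplane.
- by move=> xi Hx; rewrite !mulr_ge0 ?powR_ge0 ?F_ge0.
- by have := Ffin Hz; rewrite ge0_fin_numE// abs_op_ge0.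
Qed.

Let G_dominated z xi : halfplane xi ->
  `|Gre z xi| <= dominating z xi /\ `|Gim z xi| <= dominating z xi.
Proof.
move=> Hx; have y0 : 0 <= xi.2 `^ alpha by exact: powR_ge0.
rewrite /Gre /Gim /dominating mulrA -normc_bergman_integrand !normrM (ger0_norm y0).
by split; apply: ler_wpM2r => //; [exact: Re_le_normc|exact: Im_le_normc].
Qed.

Let G_integrable z (G : R * R -> R) : halfplane z -> measurable_fun halfplane G ->
  (forall xi, halfplane xi -> `|G xi| <= dominating z xi) ->
  area.-integrable halfplane (EFin \o G).
Proof.
move=> Hz mG dG; have mH := @measurable_halfplane R.
exact: (le_integrable_area mH mG dG (dominating_integrable Hz)).
Qed.

Let G_integral_le z (G : R * R -> R) : halfplane z -> measurable_fun halfplane G ->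
  (forall xi, halfplane xi -> `|G xi| <= dominating z xi) ->
  `|fine (\int[area]_(xi in halfplane) (G xi)%:E)| <= fine (abs_op alpha F z).
Proof.
move=> Hz mG dG; have mH := @measurable_halfplane R.
exact: (norm_Rintegral_le_area mH mG dG (dominating_integrable Hz)).
Qed.

Lemma integrable_bergman_integrand z : halfplane z ->
  integrable_dA alpha (bergman_integrand alpha f z).
Proof.
move=> Hz; have [m1 m2] := measurable_G.
split.
  apply: (G_integrable Hz (section_measurable Hz m1)) => xi Hx.
  by have [] := G_dominated z Hx.
apply: (G_integrable Hz (section_measurable Hz m2)) => xi Hx.
by have [] := G_dominated z Hx.
Qed.

Let k := bergman_cst alpha : R[i].

Let cint z := cint_dA alpha (bergman_integrand alpha f z).

Let cintE z : cint z = fine (\int[area]_(xi in halfplane) (Gre z xi)%:E) +i*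
  fine (\int[area]_(xi in halfplane) (Gim z xi)%:E).
Proof. by rewrite /cint /cint_dA !int_dA_halfplane. Qed.

(** The real and imaginary parts of the integral are estimated separately, whence
    the factor 2. *)
Lemma bergman_proj_pointwise z : halfplane z ->
  normc (bergman_proj alpha f z) <= normc k * (2 * fine (abs_op alpha F z)).
Proof.
move=> Hz; have [m1 m2] := measurable_G.
rewrite /bergman_proj /bergman_op normcM ler_wpM2l ?normc_ge0//.
rewrite -/(cint z); apply: le_trans (normc_le_ReIm _) _.
rewrite cintE mulr_natl mulr2n; apply: lerD.
  apply: (G_integral_le Hz (section_measurable Hz m1)) => xi Hx.
  by have [] := G_dominated z Hx.
apply: (G_integral_le Hz (section_measurable Hz m2)) => xi Hx.
by have [] := G_dominated z Hx.
Qed.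

Lemma measurable_bergman_proj :
  measurable_fun halfplane (fun z => Re (bergman_proj alpha f z)) /\
  measurable_fun halfplane (fun z => Im (bergman_proj alpha f z)).
Proof.
have [m1 m2] := measurable_G.
have mre : measurable_fun halfplane (fun z => Re (cint z)).
  under eq_fun do rewrite cintE.
  apply: (measurableT_comp (fine_measurable measurableT)).
  exact: measurable_signed_area_integral.
have mim : measurable_fun halfplane (fun z => Im (cint z)).
  under eq_fun do rewrite cintE.
  apply: (measurableT_comp (fine_measurable measurableT)).
  exact: measurable_signed_area_integral.
split.
  under eq_fun do rewrite /bergman_proj /bergman_op ReM -/(cint _).
  by apply: measurable_funB; apply: measurable_funM.
under eq_fun do rewrite /bergman_proj /bergman_op ImM -/(cint _).
by apply: measurable_funD; apply: measurable_funM.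
Qed.

(** Depends on [p] and [alpha] alone: [k] is the normalizing constant of the
    projection, of which nothing but the modulus matters. *)
Definition bergman_const : R :=
  normc k * 2 * operator_const p alpha `^ p^-1.

(** [abs_op_bound] applied to [|f|], then a [p]-th root. *)
Lemma bergman_proj_bound :
  (Lp_norm p alpha w (bergman_proj alpha f) <=
   bergman_const%:E * bekolle_cst p alpha w `^ (Num.max 1 (p - 1)^-1)%R
   * Lp_norm p alpha w f)%E.
Proof.
set e := Num.max 1 (p - 1)^-1.
pose B := fine (bekolle_cst p alpha w).
pose Psi := \int[area]_(z in halfplane) psi z.
have mH := @measurable_halfplane R.
have k0 : 0 <= normc k * 2 by rewrite mulr_ge0 ?normc_ge0.
have w0 := weight_gt0 bw.
have Psi0 : 0 <= Psi by apply: Rintegral_ge0 => z; exact: psi_ge0.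
have oc0 : 0 <= operator_const p alpha by exact: operator_const_ge0.
have [m1 m2] := measurable_bergman_proj.
have maop : measurable_fun halfplane (fun z => fine (abs_op alpha F z)).
  apply: (measurableT_comp (fine_measurable measurableT)).
  exact: measurable_abs_op.
have bound : (\int[area]_(z in halfplane)
    (normc (bergman_proj alpha f z) `^ p * w z * z.2 `^ alpha)%:E <=
    ((normc k * 2) `^ p * (operator_const p alpha * (B `^ e) `^ p * Psi))%:E)%E.
  have A := abs_op_bound p1 al bw mF F_ge0 integrable_psi.
  rewrite EFinM; apply: (@le_trans _ _ (((normc k * 2) `^ p)%:E *
      \int[area]_(z in halfplane) (fine (abs_op alpha F z) `^ p * (w z * z.2 `^ alpha))%:E)%E);
    last by rewrite lee_wpmul2l ?lee_fin ?powR_ge0.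
  have mw : measurable_fun halfplane (fun z => w z * z.2 `^ alpha).
    by apply: measurable_funM; [exact: measurable_weight bw|exact: measurable_density].
  have ma : measurable_fun halfplane
      (fun z => fine (abs_op alpha F z) `^ p * (w z * z.2 `^ alpha)).
    by apply: measurable_funM => //; exact: measurable_fun_powR_comp.
  have u0 z : halfplane z -> 0 <= w z * z.2 `^ alpha.
    by move=> Hz; rewrite mulr_ge0 ?powR_ge0// ltW// w0.
  rewrite -ge0_integralZl_area//; last 2 first.
  - by move=> z Hz; rewrite mulr_ge0 ?powR_ge0// u0.
  - exact: powR_ge0.
  apply: ge0_le_integral_area => //.
  - apply: measurable_funM; last exact: measurable_density.
    apply: measurable_funM; last exact: measurable_weight bw.
    by apply: measurable_fun_powR_comp; exact: measurable_normc.
  - by apply: measurable_funM.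
  - move=> z Hz; rewrite -mulrA mulr_ge0 ?powR_ge0 ?u0//= [leRHS]mulrA ler_wpM2r ?u0//.
    have a0 : 0 <= fine (abs_op alpha F z) by rewrite fine_ge0// abs_op_ge0.
    rewrite -powRM//; apply: ge0_ler_powR; rewrite ?nnegrE ?(ltW p0) ?normc_ge0//.
      exact: mulr_ge0.
    by rewrite -mulrA bergman_proj_pointwise.
have PsiE : (\int[area]_(z in halfplane) (psi z)%:E = Psi%:E)%E.
  by apply: integral_EFin_Rintegral => //; exact: integrable_psi.
rewrite Lp_norm_psi PsiE.
rewrite (bekolle_cstE p1 al bw) -/B !poweR_EFin -!EFinM.
rewrite /Lp_norm (int_dA_halfplane (fun z => normc (bergman_proj alpha f z) `^ p * w z)).
apply: le_trans (_ : ((((normc k * 2) `^ p *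
   (operator_const p alpha * (B `^ e) `^ p * Psi))%:E) `^ p^-1 <= _)%E).
  apply: gt0_ler_poweR => //.
  - by rewrite invr_ge0 ltW.
  - rewrite in_itv/= leey andbT; apply: integral_ge0 => z Hz.
    by rewrite lee_fin !mulr_ge0 ?powR_ge0// ltW// w0.
  - rewrite in_itv/= leey andbT lee_fin.
    exact: mulr_ge0 (powR_ge0 _ _) (mulr_ge0 (mulr_ge0 oc0 (powR_ge0 _ _)) Psi0).
rewrite poweR_EFin lee_fin.
have pp (x : R) : 0 <= x -> (x `^ p) `^ p^-1 = x.
  by move=> x0; rewrite -powRrM divff ?powRr1// gt_eqF.
have Be0 : 0 <= B `^ e := powR_ge0 _ _.
have Bep0 : 0 <= (B `^ e) `^ p := powR_ge0 _ _.
rewrite (powRM _ (powR_ge0 _ _) (mulr_ge0 (mulr_ge0 oc0 Bep0) Psi0)).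
rewrite (powRM _ (mulr_ge0 oc0 Bep0) Psi0) (powRM _ oc0 Bep0) !pp//.
by rewrite /bergman_const !mulrA.
Qed.

Lemma bergman_const_ge0 : 0 <= bergman_const.
Proof. by rewrite /bergman_const !mulr_ge0 ?powR_ge0 ?normc_ge0. Qed.

End bergman_projection.

Theorem corollary1p7 (R : realType) (p alpha : R) :
  1 < p -> -1 < alpha ->
  exists C : R, forall w : R * R -> R, bekolle_weight p alpha w ->
    forall f : R * R -> R[i], Lp_space p alpha w f ->
      [/\ forall z, halfplane z -> integrable_dA alpha (bergman_integrand alpha f z),
          Lp_space p alpha w (bergman_proj alpha f) &
          (Lp_norm p alpha w (bergman_proj alpha f)
             <= C%:E * bekolle_cst p alpha w `^ (Num.max 1 (p - 1)^-1)%R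
                * Lp_norm p alpha w f)%E].
Proof.
move=> p1 al; exists (bergman_const p alpha) => w bw f Lf.
have bound := bergman_proj_bound p1 al bw Lf.
split; [|split|exact: bound].
- by move=> z; exact: integrable_bergman_integrand p1 al bw Lf z.
- by have [] := measurable_bergman_proj Lf.
- by have [] := measurable_bergman_proj Lf.
- apply: le_lt_trans bound _.
  have [_ _ ffin] := Lf.
  rewrite (bekolle_cstE p1 al bw) poweR_EFin -EFinM.
  apply: lte_mul_pinfty ffin => //; rewrite lee_fin.
  exact: mulr_ge0 (bergman_const_ge0 _ _) (powR_ge0 _ _).
Qed.
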